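(* Let $J\in\{[0,\infty),\mathbb{R}\}$, let $X$ be a complex Banach space, let $\mathfrak{g}(t)=e^{it^2}$ for $t\in\mathbb{R}$, and let $\mathcal{U},\mathcal{V}\in\{BUC(J,X),UC(J,X)\}$. Let $f\in L^1_{loc}(J,X)$ be such that $\Delta_s f\in\mathcal{U}+\mathfrak{g}\,\mathcal{V}$ for each $s>0$. Then: (i) $f\in\Delta\mathcal{U}+\mathfrak{g}\,BUC(J,X)$. (ii) $M_hf\in\Delta\mathcal{U}$ for each $h>0$. (iii) $\mathcal{U}+\mathfrak{g}\,\mathcal{V}$ has $(\Delta)$.
   Context: For $f:J\to X$ and $s>0$, $(\Delta_s f)(t)=f(t+s)-f(t)$. For $f\in L^1_{loc}(J,X)$ and $h>0$, $M_hf(t)=\frac1h\int_0^h f(t+s)\,ds$, $t\in J$. $UC(J,X)$ and $BUC(J,X)$ denote the spaces of uniformly continuous (not necessarily bounded) and bounded uniformly continuous functions $J\to X$; $\mathfrak{g}\,\mathcal{V}=\{\mathfrak{g}v:v\in\mathcal{V}\}$; $\Delta\mathcal{U}=\{\phi\in L^1_{loc}(J,X):\Delta_h\phi\in\mathcal{U}\text{ for all }h>0\}$. A class $\mathcal{A}\subset L^1_{loc}(J,X)$ has (satisfies) $(\Delta)$ if for every $f\in L^1_{loc}(J,X)$ with $\Delta_s f\in\mathcal{A}$ for all $s>0$ one has $f-M_hf\in\mathcal{A}$ for all $h>0$. *)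

(* Defs.v *)
From HB Require Import structures.
From mathcomp Require Import all_boot all_order all_algebra.
From mathcomp Require Import all_classical all_reals all_analysis.
From mathcomp Require Import complex.
Set Implicit Arguments.
Unset Strict Implicit.
Unset Printing Implicit Defensive.
Import Order.TTheory GRing.Theory Num.Theory.
Import numFieldNormedType.Exports.
Local Open Scope classical_set_scope.
Local Open Scope ring_scope.
Local Open Scope complex_scope.

(* A normed space X over R[i] has its norm in R[i], with values that are real
   and nonnegative; this is that norm as an element of R. *)
Definition rnorm (R : realType) (X : normedModType R[i]) (x : X) : R :=
  complex.Re `|x|.

Section Bochner.
Context {d : measure_display} {T : measurableType d} {R : realType}.
Context {X : completeNormedModType R[i]}.
Variables (mu : {measure set T -> \bar R}) (D : set T).
Implicit Types (f s : T -> X) (I : X).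

Definition simple_fun s :=
  [/\ finite_set (range s),
      forall x, measurable (s @^-1` [set x]) &
      forall x, x != 0 -> (mu (D `&` s @^-1` [set x]) < +oo)%E].

Definition simple_integral s : X :=
  \sum_(x \in range s) (fine (mu (D `&` s @^-1` [set x])))%:C *: x.

Definition strongly_measurable f :=
  exists s_ : nat -> T -> X, (forall n, simple_fun (s_ n)) /\
    {ae mu, forall t, D t -> s_ ^~ t @ \oo --> f t}.

(* The simple functions are mu-measurable without completion, so f need only
   agree almost everywhere with a measurable function. The integral below is
   the library's supremum over smaller simple functions, hence it has the value
   of the integral with respect to the completion of mu. *)
Definition simple_approx f (s_ : nat -> T -> X) :=
  (forall n, simple_fun (s_ n)) /\
  (fun n => \int[mu]_(t in D) (rnorm (f t - s_ n t))%:E)%E @ \oo --> 0%E.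

Definition bochner_integrable f :=
  strongly_measurable f /\ exists s_ : nat -> T -> X, simple_approx f s_.

Definition is_bochner_integral f I :=
  exists s_ : nat -> T -> X, simple_approx f s_ /\ simple_integral \o s_ @ \oo --> I.

(* Only meaningful for integrable f. *)
Definition bochner_integral f : X := xget 0 [set I | is_bochner_integral f I].

End Bochner.

(* An element of L^1_loc(J, X) is a class of functions modulo equality almost
   everywhere on J. It is represented by any f : R -> X whose restriction to J
   belongs to the class: the values outside J are irrelevant, and every set of
   functions below is closed under equality almost everywhere on J. *)
Section FunctionClasses.
Context {R : realType} {X : completeNormedModType R[i]}.
Local Notation mu := (@lebesgue_measure R).
Variable J : set R.
Implicit Types (f g phi : R -> X) (A B : set (R -> X)).

Definition ae_class A : set (R -> X) :=
  [set f | exists2 g, A g & f = g %[ae mu in J]].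

Definition L1loc : set (R -> X) :=
  [set f | forall K, compact K -> K `<=` J -> bochner_integrable mu K f].

Definition UC : set (R -> X) :=
  ae_class [set f | unif_continuous (f : subspace J -> X)].

Definition BUC : set (R -> X) :=
  ae_class [set f | unif_continuous (f : subspace J -> X) /\
                    [bounded f t | t in J]].

Definition difference (s : R) f : R -> X := fun t => f (t + s) - f t.

Definition mean (h : R) f : R -> X :=
  fun t => (h^-1)%:C *: bochner_integral mu `[0, h] (fun s => f (t + s)).

Definition Delta A : set (R -> X) :=
  [set phi | L1loc phi /\ forall h, 0 < h -> A (difference h phi)].

Definition has_Delta A :=
  forall f, L1loc f -> (forall s, 0 < s -> A (difference s f)) ->
  forall h, 0 < h -> A (f \- mean h f).

Definition sum_class A B : set (R -> X) := [set u \+ v | u in A & v in B].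

Definition mul_class (g : R -> R[i]) A : set (R -> X) :=
  [set (fun t => g t *: v t) | v in A].

End FunctionClasses.

(* t |-> e^(i t^2) *)
Definition chirp (R : realType) (t : R) : R[i] :=
  cos (t ^+ 2) +i* sin (t ^+ 2).

(* Main.v *)
(** Write g(t) = exp(i t^2) and D_s f(t) = f(t + s) - f(t), and let
    D_s f = u_s + g v_s for s > 0. Since g(t + s) / g(t) = exp(i (2st + s^2)),
    the cocycle identity for D_s f forces every v_s to be bounded.

    Baire's theorem in the variable s makes the moduli of continuity of the
    D_s f uniform for s in some interval; averaging over that interval transfers
    them to f - M_h f. Applied to the mollified functions M_k f as k -> 0, this
    shows that f is almost everywhere equal to a continuous function. Applied to
    the two parts of D_s f, it shows that f - M_h f = u + g v with u in U and v
    in BUC, which is (iii). To make the parts of F = u + g v canonical, let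
    y(t) = pi / (2 |t|), a half period of g at t: as g(t + y(t)) is nearly
    - g(t), u and v are (F(t) + F(t + y(t))) / 2 and
    conj(g(t)) (F(t) - F(t + y(t))) / 2 up to functions that vanish at infinity.

    As M_h maps g BUC to BUC, all differences of M_h f lie in U, which is (ii),
    and then f = (u + M_h f) + g v gives (i). *)
Require Import Defs.
From HB Require Import structures.
From mathcomp Require Import all_boot all_order all_algebra.
From mathcomp Require Import all_classical all_reals all_analysis.
From mathcomp Require Import complex ring lra measurable_realfun.
Set Implicit Arguments.
Unset Strict Implicit.
Unset Printing Implicit Defensive.
Import Order.TTheory GRing.Theory Num.Theory.
Import numFieldNormedType.Exports.
Local Open Scope classical_set_scope.
Local Open Scope ring_scope.

(** * Real-valued norms *)

(* Decides identities in a commutative group: after moving everything to one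
   side, the last term is cancelled with its opposite until nothing is left. *)
Ltac zmodule := apply/eqP; rewrite -subr_eq0; apply/eqP;
  rewrite ?(opprD, opprK, addrA) -[LHS]add0r ?addrA;
  repeat (lazymatch goal with
  | |- _ + - ?x = 0 => rewrite ?[_ + x + _]addrAC subrK
  | |- _ + ?x = 0 => rewrite ?[_ + - x + _]addrAC addrK
  end); reflexivity.

Lemma exists_invS_le (R : archiRealFieldType) (e : R) : 0 < e ->
  exists n, n.+1%:R^-1 <= e.
Proof.
move=> e0; exists (Num.truncn e^-1).
by rewrite invf_ple ?posrE// ltW// truncnS_gt.
Qed.

Section Modulus.
Context {R : realType}.
Implicit Types (z w : R[i]).
Local Open Scope complex_scope.

Definition cmod z : R := complex.Re `|z|.

Lemma cmodE z : `|z| = (cmod z)%:C.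
Proof. by rewrite /cmod normc_def. Qed.

Lemma cmod_sqrt (a b : R) : cmod (a +i* b) = Num.sqrt (a ^+ 2 + b ^+ 2).
Proof. by rewrite /cmod normc_def. Qed.

Lemma cmod_ge0 z : 0 <= cmod z.
Proof. by rewrite /cmod normc_def/= sqrtr_ge0. Qed.

Lemma cmod_leD z w : cmod (z + w) <= cmod z + cmod w.
Proof. by rewrite -lecR rmorphD/= -!cmodE ler_normD. Qed.

Lemma cmodN z : cmod (- z) = cmod z.
Proof. by rewrite /cmod normrN. Qed.

Lemma cmod_dist z w : cmod z - cmod w <= cmod (z - w).
Proof. by rewrite lerBlDr (le_trans _ (cmod_leD _ _))// subrK. Qed.

End Modulus.

Section RealNorm.
Context {R : realType} {X : normedModType R[i]}.
Implicit Types (x y : X) (c : R[i]).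
Local Open Scope complex_scope.

Lemma rnormE x : `|x| = (rnorm x)%:C.
Proof. by apply/esym/RRe_real. Qed.

Lemma rnorm_ge0 x : 0 <= rnorm x.
Proof. by rewrite -lecR -rnormE; exact: normr_ge0. Qed.

Lemma rnorm0 : rnorm (0 : X) = 0.
Proof. by rewrite /rnorm normr0. Qed.

Lemma rnorm0_eq0 x : rnorm x = 0 -> x = 0.
Proof. by move=> x0; apply/normr0_eq0; rewrite rnormE x0. Qed.

Lemma rnormN x : rnorm (- x) = rnorm x.
Proof. by rewrite /rnorm normrN. Qed.

Lemma rnormB x y : rnorm (x - y) = rnorm (y - x).
Proof. by rewrite -rnormN opprB. Qed.

Lemma rnorm_leD x y : rnorm (x + y) <= rnorm x + rnorm y.
Proof. by rewrite -lecR rmorphD/= -!rnormE ler_normD. Qed.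

Lemma rnorm_leB x y : rnorm (x - y) <= rnorm x + rnorm y.
Proof. by rewrite (le_trans (rnorm_leD _ _))// rnormN. Qed.

Lemma rnormZ c x : rnorm (c *: x) = cmod c * rnorm x.
Proof.
apply: complexI; rewrite -rnormE normrZ rmorphM/= -rnormE; congr (_ * _).
Qed.

Lemma rnormZr (a : R) x : rnorm (a%:C *: x) = `|a| * rnorm x.
Proof. by rewrite rnormZ cmod_sqrt expr0n/= addr0 sqrtr_sqr. Qed.

Lemma rnorm_dist x y : `|rnorm x - rnorm y| <= rnorm (x - y).
Proof.
rewrite ler_norml; have := rnorm_leD (x - y) y; have := rnorm_leD (y - x) x.
by rewrite !subrK (rnormB y x); lra.
Qed.

Lemma rnorm_small x : (forall e, 0 < e -> rnorm x <= e) -> x = 0.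
Proof.
move=> xe; apply: rnorm0_eq0; apply/eqP; rewrite eq_le rnorm_ge0 andbT.
by apply/ler_addgt0Pr => e e0; rewrite add0r xe.
Qed.

Lemma cvg_rnormP {T} {F : set_system T} {FF : Filter F} (u : T -> X) (l : X) :
  u @ F --> l <-> forall e : R, 0 < e -> \forall t \near F, rnorm (l - u t) < e.
Proof.
split=> [/cvgrPdist_lt ul e e0|ul].
  have /= := ul e%:C; rewrite ltcR => /(_ e0); apply: filterS => t.
  by rewrite rnormE ltcR.
apply/cvgrPdist_lt => e e0.
have eE : e = (complex.Re e)%:C by exact/esym/RRe_real/gtr0_real.
have Re0 : 0 < complex.Re e by rewrite -ltcR -eE.
by apply: filterS (ul _ Re0) => t; rewrite rnormE eE ltcR.
Qed.

Lemma cvg_rnorm_seqP (u : nat -> X) (l : X) :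
  u @ \oo --> l <->
  forall e : R, 0 < e -> exists N, forall n, (N <= n)%N -> rnorm (l - u n) < e.
Proof.
split=> [/cvg_rnormP ul e e0|ul].
  by have [N _ uN] := ul _ e0; exists N => n Nn; apply: uN.
apply/cvg_rnormP => e e0; have [N uN] := ul _ e0.
by exists N => // n /= /uN.
Qed.

End RealNorm.

Lemma rnorm_complete (R : realType) (X : completeNormedModType R[i]) (u : nat -> X) :
  (forall e : R, 0 < e ->
    exists N, forall m n, (N <= m)%N -> (N <= n)%N -> rnorm (u m - u n) < e) ->
  exists l : X, u @ \oo --> l.
Proof.
move=> uC; suff : cvg (u @ \oo) by move/cvg_ex.
apply: cauchy_cvg; apply: cauchy_exP => e e0.
have eE : e = (complex.Re e)%:C%C by exact/esym/RRe_real/gtr0_real.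
have Re0 : 0 < complex.Re e by rewrite -ltcR -eE.
have [N uN] := uC _ Re0.
exists (u N); exists N => // n /= Nn; rewrite -ball_normE/= rnormE eE ltcR.
exact: uN.
Qed.

Section UniformlyContinuous.
Context {R : realType} {X : normedModType R[i]}.
Variable J : set R.
Local Open Scope complex_scope.

Lemma unif_continuous_subspaceP (f : R -> X) :
  unif_continuous (f : subspace J -> X) <->
  forall e : R, 0 < e -> exists2 d : R, 0 < d &
    forall s t, J s -> J t -> `|s - t| < d -> rnorm (f s - f t) < e.
Proof.
split=> [uf e e0|uf].
  pose E := [set xy : X * X | ball xy.1 e%:C xy.2].
  have entE : entourage E by rewrite -entourage_ballE; exists e%:C => //=; rewrite ltcR.
  have [V entV VE] := uf _ entE.
  move: entV; rewrite -entourage_ballE => -[d /= d0 dV].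
  exists d => // s t Js Jt st.
  have : E (f s, f t).
    apply: (VE (s, t)) => /=; right; do 2 split => //.
    by apply: dV => /=; rewrite /ball/=.
  by rewrite /E/= -ball_normE/= rnormE ltcR.
move=> E; rewrite -entourage_ballE => -[e /= e0 eE].
have eRe : e = (complex.Re e)%:C by exact/esym/RRe_real/gtr0_real.
have Re0 : 0 < complex.Re e by rewrite -ltcR -eRe.
have [d d0 fd] := uf _ Re0.
exists [set xy : R * R | ball xy.1 d xy.2].
  by rewrite -entourage_ballE; exists d.
move=> [s t] /= [-> | [Js [Jt st]]]; apply: eE => /=; first exact: ballxx.
by rewrite -ball_normE/= rnormE eRe ltcR fd.
Qed.

Lemma bounded_rnormP (f : R -> X) :
  [bounded f t | t in J] <-> exists C : R, forall t, J t -> rnorm (f t) <= C.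
Proof.
split=> [[M [Mr fM]]|[C fC]].
  have ME : M = (complex.Re M)%:C by exact/esym/RRe_real.
  exists (complex.Re M + 1) => t Jt; rewrite -lecR -rnormE; apply: fM => //.
  by rewrite ME ltcR ltrDl.
exists C%:C; split; first exact/complex_realP/(ex_intro _ C).
move=> y Cy t Jt; rewrite /= rnormE (le_trans _ (ltW Cy))// lecR.
exact: fC.
Qed.

End UniformlyContinuous.

(** * The Bochner integral *)

Section FinitelyValued.
Context {d : measure_display} {T : measurableType d}.

Definition finitely_valued (I : choiceType) (phi : T -> I) :=
  finite_set (range phi) /\ forall i, measurable (phi @^-1` [set i]).

Lemma finitely_valued_preimage (I : choiceType) (phi : T -> I) (A : set I) :
  finitely_valued phi -> measurable (phi @^-1` A).
Proof.
move=> [fphi mphi].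
rewrite (_ : _ @^-1` _ = \bigcup_(i in range phi `&` A) phi @^-1` [set i]).
  by apply: fin_bigcup_measurable => [|i _]; [exact: finite_setIl|exact: mphi].
apply/seteqP; split => [t At|t [i [_ Ai] /= ->//]].
by exists (phi t).
Qed.

Lemma finitely_valued_comp (I I' : choiceType) (phi : T -> I) (c : I -> I') :
  finitely_valued phi -> finitely_valued (c \o phi).
Proof.
move=> fphi; split.
  apply: (@sub_finite_set _ _ (c @` range phi)).
    by move=> _ [t _ <-]; exists (phi t) => //; exists t.
  by apply: finite_image; exact: fphi.1.
by move=> i; rewrite comp_preimage; exact: finitely_valued_preimage.
Qed.

Lemma finitely_valued_pair (I I' : choiceType) (phi : T -> I) (psi : T -> I') :
  finitely_valued phi -> finitely_valued psi ->
  finitely_valued (fun t => (phi t, psi t)).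
Proof.
move=> [fphi mphi] [fpsi mpsi]; split.
  apply: (@sub_finite_set _ _ (range phi `*` range psi)); last exact: finite_setX.
  by move=> _ [t _ <-]; split; exists t.
move=> [i j].
rewrite (_ : _ @^-1` _ = phi @^-1` [set i] `&` psi @^-1` [set j]).
  exact: measurableI.
by apply/seteqP; split => [t [<- <-]|t [/= <- <-]].
Qed.

Lemma finitely_valued_cst (I : choiceType) (i : I) :
  finitely_valued (fun _ : T => i).
Proof.
split; first by apply: (@sub_finite_set _ _ [set i]) => // _ [t _ <-].
by move=> j; rewrite preimage_cst; case: ifP.
Qed.

Lemma finitely_valued_mem (A : set T) :
  measurable A -> finitely_valued (fun t => t \in A).
Proof.
move=> mA; split; first exact: finite_finset.
case.
  rewrite (_ : _ @^-1` _ = A)//; apply/seteqP; split => [t|t At].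
    exact: set_mem.
  exact: mem_set.
rewrite (_ : _ @^-1` _ = ~` A); first exact: measurableC.
apply/seteqP; split => [t /= tA At|t nAt]; last exact: memNset.
by rewrite mem_set in tA.
Qed.

Lemma finitely_valued_measurable (R : realType) (h : T -> R) (D : set T) :
  finitely_valued h -> measurable D -> measurable_fun D h.
Proof.
by move=> fh mD _ Y _; apply: measurableI => //; apply: finitely_valued_preimage.
Qed.

End FinitelyValued.

Section BochnerTheory.
Context {d : measure_display} {T : measurableType d} {R : realType}.
Context {X : completeNormedModType R[i]}.
Variables (mu : {measure set T -> \bar R}) (D : set T).
Hypotheses (mD : measurable D) (muD : (mu D < +oo)%E).
Implicit Types (f g s : T -> X) (I : X).
Local Open Scope complex_scope.

Lemma simple_funP s : simple_fun mu D s <-> finitely_valued s.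
Proof.
split=> [[fs ms _]|fs]; first by split.
split => [||x _]; [by case: fs|by case: fs|].
apply: (le_lt_trans _ muD); apply: le_measure; rewrite ?inE//.
by apply: measurableI => //; exact: fs.2.
Qed.

Let mass (A : set T) : R := fine (mu (D `&` A)).

Let massE A : measurable A -> (mass A)%:E = mu (D `&` A).
Proof.
move=> mA; rewrite /mass fineK// ge0_fin_numE//.
apply: (le_lt_trans _ muD); apply: le_measure; rewrite ?inE//.
exact: measurableI.
Qed.

Let mass_preimage (I : choiceType) (phi : T -> I) (A : set I) :
  finitely_valued phi ->
  mass (phi @^-1` A) = \sum_(i \in range phi `&` A) mass (phi @^-1` [set i]).
Proof.
move=> fphi; have [fr mphi] := fphi; apply: EFin_inj.
rewrite massE; last exact: finitely_valued_preimage.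
have fA : finite_set (range phi `&` A) by exact: finite_setIl.
rewrite -fsumEFin//.
transitivity (mu (\bigcup_(i in range phi `&` A) (D `&` phi @^-1` [set i]))).
  congr (mu _); apply/seteqP; split => [t [Dt At]|t [i [_ Ai] [Dt /= it]]].
    by exists (phi t).
  by split => //=; rewrite it.
rewrite measure_fin_bigcup//.
- by apply: eq_fsbigr => i _; rewrite massE.
- by move=> i j _ _ [t [[_ /= <-] [_ /= <-]]].
- by move=> i _; apply: measurableI.
Qed.

Lemma simple_integral_comp (I : choiceType) (phi : T -> I) (c : I -> X) :
  finitely_valued phi ->
  simple_integral mu D (c \o phi) =
  \sum_(i \in range phi) (mass (phi @^-1` [set i]))%:C *: c i.
Proof.
move=> fphi; have [fr mphi] := fphi.
have fs : finite_set (range (c \o phi)).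
  by case: (finitely_valued_comp c fphi).
rewrite /simple_integral.
transitivity (\sum_(x \in range (c \o phi)) \sum_(i \in range phi)
   if c i == x then (mass (phi @^-1` [set i]))%:C *: c i else 0).
  apply: eq_fsbigr => x _; rewrite -/(mass _) comp_preimage mass_preimage//.
  have fA : finite_set (range phi `&` c @^-1` [set x]) by exact: finite_setIl.
  rewrite fsbig_finite//= rmorph_sum/= scaler_suml -fsbig_finite//.
  rewrite fsbig_mkcondr; apply: eq_fsbigr => i _.
  case: ifPn => [|]; first by rewrite inE /= => ->; rewrite eqxx.
  by rewrite notin_setE /= => /eqP/negbTE ->.
rewrite exchange_fsbig//; apply: eq_fsbigr => i; rewrite inE => -[t _ ti].
rewrite (fsbigD1 (c i))//=; last by exists t => //=; rewrite ti.
rewrite eqxx fsbig1 ?addr0// => x [_ /= /eqP]; rewrite eq_sym => /negbTE ->//.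
Qed.

Lemma simple_integralD s s' : finitely_valued s -> finitely_valued s' ->
  simple_integral mu D (s \+ s') = simple_integral mu D s + simple_integral mu D s'.
Proof.
move=> fs fs'; have fp := finitely_valued_pair fs fs'.
rewrite (@simple_integral_comp _ _ (fun p : X * X => p.1 + p.2) fp).
rewrite (@simple_integral_comp _ _ (fun p : X * X => p.1) fp).
rewrite (@simple_integral_comp _ _ (fun p : X * X => p.2) fp).
rewrite -fsbig_split//=; last by case: fp.
by apply: eq_fsbigr => p _; rewrite scalerDr.
Qed.

Lemma simple_integralZ (c : R[i]) s : finitely_valued s ->
  simple_integral mu D (fun t => c *: s t) = c *: simple_integral mu D s.
Proof.
move=> fs; rewrite (@simple_integral_comp _ _ (fun x : X => c *: x) fs).
rewrite /simple_integral !fsbig_finite//=; try by case: fs.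
rewrite scaler_sumr; apply: eq_bigr => x _.
by rewrite !scalerA mulrC.
Qed.

Lemma rnorm_simple_integral s : finitely_valued s ->
  ((rnorm (simple_integral mu D s))%:E <= \int[mu]_(t in D) (rnorm (s t))%:E)%E.
Proof.
move=> fs; have [fr ms] := fs.
have -> : (\int[mu]_(t in D) (rnorm (s t))%:E =
    \int[mu]_(t in D) \sum_(x \in range s)
      ((rnorm x)%:E * (\1_(s @^-1` [set x]) t)%:E))%E.
  apply: eq_integral => t _; rewrite (fsbigD1 (s t))//=; last by exists t.
  rewrite indicE mem_set// mule1 fsbig1 ?adde0// => x [_ /= xs].
  by rewrite indicE memNset ?mule0// => /esym.
rewrite ge0_integral_fsum//; last 2 first.
- move=> x; apply: measurable_funeM; apply/measurable_EFinP.
  exact: measurable_indic.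
- by move=> x t _; rewrite mule_ge0// lee_fin ?rnorm_ge0// indicE.
have -> : (\sum_(x \in range s)
    \int[mu]_(t in D) ((rnorm x)%:E * (\1_(s @^-1` [set x]) t)%:E) =
    (\sum_(x \in range s) mass (s @^-1` [set x]) * rnorm x)%R%:E)%E.
  rewrite -fsumEFin//; apply: eq_fsbigr => x _.
  have mx : measurable_fun D (fun t => (\1_(s @^-1` [set x]) t)%:E : \bar R).
    by apply/measurable_EFinP; exact: measurable_indic.
  rewrite (ge0_integralZl mu mD mx) ?lee_fin ?rnorm_ge0//.
  by rewrite integral_indic// setIC -massE// -EFinM mulrC.
rewrite lee_fin /simple_integral !fsbig_finite//=.
elim/big_ind2 : _ => [|x a y b xa yb|x _].
- by rewrite rnorm0.
- by rewrite (le_trans (rnorm_leD _ _))// lerD.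
- by rewrite rnormZr ger0_norm// fine_ge0.
Qed.

End BochnerTheory.

Section L1Norm.
Import HBNNSimple.
Context {d : measure_display} {T : measurableType d} {R : realType}.
Variables (mu : {measure set T -> \bar R}) (D : set T).
Hypothesis mD : measurable D.

(* The integral of a nonnegative function is a supremum over simple functions,
   so that no measurability is needed here. *)
Lemma ge0_ae_le_integral (h k : T -> \bar R) :
  (forall t, D t -> (0 <= h t)%E) -> (forall t, D t -> (0 <= k t)%E) ->
  {ae mu, forall t, D t -> (h t <= k t)%E} ->
  (\int[mu]_(t in D) h t <= \int[mu]_(t in D) k t)%E.
Proof.
move=> h0 k0 [N [mN N0 hkN]].
rewrite !ge0_integralE//; apply/ge_ereal_sup => _ [s sh <-].
pose s' := mul_nnsfun s (indic_nnsfun R (measurableC mN)).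
have -> : sintegral mu s = sintegral mu s'.
  rewrite -!integralT_nnsfun; apply: ge0_ae_eq_integral => //.
  - by apply/measurable_EFinP.
  - by apply/measurable_EFinP.
  - by move=> t _; rewrite lee_fin.
  - by move=> t _; rewrite lee_fin.
  exists N; split => // t /= st; apply: contrapT => Nt; apply: st => _.
  by rewrite /s' /= mindicE mem_set// mulr1.
apply: ereal_sup_ubound; exists s' => // t /=.
have := sh t; rewrite /= mindicE !patchE; case: ifPn => [|tD].
  rewrite inE => Dt st; have [tN|tN] := boolP (t \in ~` N).
    rewrite mulr1 (le_trans st)//; apply: contrapT => hk.
    move: tN; rewrite inE; apply; apply: hkN => /= H; apply: hk; exact: H.
  by rewrite mulr0 k0.
move=> st; by rewrite lee_fin mulr_le0_ge0// -lee_fin.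
Qed.

Lemma ge0_ae_eq_integral_nonmeasurable (h k : T -> \bar R) :
  (forall t, D t -> (0 <= h t)%E) -> (forall t, D t -> (0 <= k t)%E) ->
  {ae mu, forall t, D t -> h t = k t} ->
  (\int[mu]_(t in D) h t = \int[mu]_(t in D) k t)%E.
Proof.
move=> h0 k0 hk; apply/eqP; rewrite eq_le.
by rewrite !ge0_ae_le_integral//; apply: filterS hk => t tD Dt; rewrite tD.
Qed.

End L1Norm.

Section StrongMeasurability.
Context {d : measure_display} {T : measurableType d} {R : realType}.
Context {X : completeNormedModType R[i]}.
Variables (mu : {measure set T -> \bar R}) (D : set T).
Hypotheses (mD : measurable D) (muD : (mu D < +oo)%E).
Implicit Types (f g s : T -> X) (I : X).
Local Open Scope complex_scope.

Lemma strongly_measurable_rnorm f : strongly_measurable mu D f ->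
  exists2 h : T -> R, measurable_fun setT h &
    (forall t, 0 <= h t) /\ {ae mu, forall t, D t -> rnorm (f t) = h t}.
Proof.
move=> [s_ [ss [N [mN N0 sN]]]].
have DN t : t \in D `\` N -> s_ ^~ t @ \oo --> f t.
  rewrite inE => -[Dt Nt]; apply: contrapT => st; apply: Nt; apply: sN => /= H.
  exact/st/H.
exists (fun t => if t \in D `\` N then rnorm (f t) else 0); last first.
  split=> [t|]; first by case: ifP => // _; exact: rnorm_ge0.
  exists N; split=> // t /= ft; apply: contrapT => Nt; apply: ft => Dt.
  by rewrite mem_set.
apply: (measurable_fun_cvg
  (h := fun n t => if t \in D `\` N then rnorm (s_ n t) else 0)).
  move=> n; apply: finitely_valued_measurable => //.
  apply: (@finitely_valued_comp _ _ _ _ (fun t => (s_ n t, t \in D `\` N))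
    (fun p : X * bool => if p.2 then rnorm p.1 else 0)).
  apply: finitely_valued_pair; first exact/(simple_funP mD muD).
  by apply: finitely_valued_mem; exact: measurableD.
move=> t _; case: ifPn => [tDN|_]; last exact: cvg_cst.
apply/cvgrPdist_lt => e e0.
have /cvg_rnormP/(_ e e0) := DN _ tDN; apply: filterS => n.
exact/le_lt_trans/rnorm_dist.
Qed.

Lemma strongly_measurable_ae f g : {ae mu, forall t, D t -> f t = g t} ->
  strongly_measurable mu D f -> strongly_measurable mu D g.
Proof.
move=> fg [s_ [ss sf]]; exists s_; split=> //.
by apply: filterS2 fg sf => t fg sf Dt; rewrite -fg//; exact: sf.
Qed.

Lemma strongly_measurable_simple s :
  finitely_valued s -> strongly_measurable mu D s.
Proof.
move=> fs; exists (fun=> s); split=> [_|]; first exact/simple_funP.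
by apply: aeW => t _; exact: cvg_cst.
Qed.

Lemma strongly_measurableD f g : strongly_measurable mu D f ->
  strongly_measurable mu D g -> strongly_measurable mu D (f \+ g).
Proof.
move=> [s [ss sf]] [s' [ss' sg]]; exists (fun n => s n \+ s' n); split=> [n|].
  apply/simple_funP => //.
  apply: (@finitely_valued_comp _ _ _ _ (fun t => (s n t, s' n t))
    (fun p : X * X => p.1 + p.2)).
  by apply: finitely_valued_pair; apply/(simple_funP mD muD).
apply: filterS2 sf sg => t sf sg Dt; apply: cvgD; [exact: sf|exact: sg].
Qed.

Lemma strongly_measurableZ (c : R[i]) f : strongly_measurable mu D f ->
  strongly_measurable mu D (fun t => c *: f t).
Proof.
move=> [s [ss sf]]; exists (fun n t => c *: s n t); split=> [n|].
  apply/simple_funP => //.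
  apply: (@finitely_valued_comp _ _ _ _ (s n) (fun x : X => c *: x)).
  exact/(simple_funP mD muD).
by apply: filterS sf => t sf Dt; apply: cvgZr; exact: sf.
Qed.

Lemma strongly_measurableB f g : strongly_measurable mu D f ->
  strongly_measurable mu D g -> strongly_measurable mu D (f \- g).
Proof.
move=> sf sg; have := strongly_measurableD sf (strongly_measurableZ (-1) sg).
by congr strongly_measurable; apply/funext => t /=; rewrite scaleN1r.
Qed.

Local Notation L1 f := (\int[mu]_(t in D) (rnorm (f t))%:E)%E.

Lemma L1_ae f g : {ae mu, forall t, D t -> f t = g t} -> L1 f = L1 g.
Proof.
move=> fg; apply: ge0_ae_eq_integral_nonmeasurable => //.
- by move=> t _; rewrite lee_fin rnorm_ge0.
- by move=> t _; rewrite lee_fin rnorm_ge0.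
by apply: filterS fg => t fg Dt; rewrite fg.
Qed.

Lemma L1_ge0 f : (0 <= L1 f)%E.
Proof. by apply: integral_ge0 => t _; rewrite lee_fin rnorm_ge0. Qed.

Lemma L1_le f g (h : T -> X) : strongly_measurable mu D f -> strongly_measurable mu D g ->
  (forall t, D t -> rnorm (h t) <= rnorm (f t) + rnorm (g t)) ->
  (L1 h <= L1 f + L1 g)%E.
Proof.
move=> /strongly_measurable_rnorm[hf mhf [hf0 fE]].
move=> /strongly_measurable_rnorm[hg mhg [hg0 gE]] hfg.
have L1E (k : T -> X) (hk : T -> R) : (forall t, 0 <= hk t) ->
    {ae mu, forall t, D t -> rnorm (k t) = hk t} ->
    L1 k = (\int[mu]_(t in D) (hk t)%:E)%E.
  move=> hk0 kE; apply: ge0_ae_eq_integral_nonmeasurable => //.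
  - by move=> t _; rewrite lee_fin rnorm_ge0.
  - by move=> t _; rewrite lee_fin.
  by apply: filterS kE => t kE Dt; rewrite kE.
rewrite (L1E f hf)// (L1E g hg)// -ge0_integralD//; last 4 first.
- by move=> t _; rewrite lee_fin.
- by apply/measurable_EFinP; exact: measurable_funTS.
- by move=> t _; rewrite lee_fin.
- by apply/measurable_EFinP; exact: measurable_funTS.
apply: ge0_ae_le_integral => //.
- by move=> t _; rewrite lee_fin rnorm_ge0.
- by move=> t _; rewrite -EFinD lee_fin addr_ge0.
apply: filterS2 fE gE => t fE gE Dt.
by rewrite -EFinD lee_fin -fE// -gE// hfg.
Qed.

Lemma L1Z (c : R[i]) f : strongly_measurable mu D f ->
  L1 (fun t => c *: f t) = ((cmod c)%:E * L1 f)%E.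
Proof.
move=> /strongly_measurable_rnorm[hf mhf [hf0 fE]].
have c0 := cmod_ge0 c.
transitivity (\int[mu]_(t in D) ((cmod c)%:E * (hf t)%:E))%E.
  apply: ge0_ae_eq_integral_nonmeasurable => //.
  - by move=> t _; rewrite lee_fin rnorm_ge0.
  - by move=> t _; rewrite -EFinM lee_fin mulr_ge0.
  by apply: filterS fE => t fE Dt; rewrite rnormZ fE.
have mh : measurable_fun D (fun t => (hf t)%:E).
  by apply/measurable_EFinP; exact: measurable_funTS.
have mh0 t : D t -> (0 <= (hf t)%:E)%E by rewrite lee_fin.
rewrite (ge0_integralZl mu mD mh mh0) ?lee_fin//; congr (_ * _)%E.
apply: ge0_ae_eq_integral_nonmeasurable => //.
- by move=> t _; rewrite lee_fin rnorm_ge0.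
by apply: filterS fE => t fE Dt; rewrite fE.
Qed.

End StrongMeasurability.

Lemma ge0_cvg_ereal0P (R : realType) (u : nat -> \bar R) :
  (forall n, (0 <= u n)%E) ->
  (u @ \oo --> 0%E <->
   forall e : R, 0 < e -> exists N, forall n, (N <= n)%N -> (u n <= e%:E)%E).
Proof.
move=> u0; split=> [/fine_cvgP[[N _ uN] /cvgrPdist_le ue] e e0|ue].
  have [M _ uM] := ue _ e0.
  exists (maxn N M) => n; rewrite geq_max => /andP[Nn Mn].
  rewrite -(fineK (uN _ Nn)) lee_fin.
  by have := uM _ Mn; rewrite /= sub0r normrN; apply/le_trans/ler_norm.
apply/fine_cvgP; split.
  have [N uN] := ue _ ltr01; exists N => // n /= Nn.
  by rewrite ge0_fin_numE// (le_lt_trans (uN _ Nn))// ltry.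
apply/cvgrPdist_le => e e0; have [N uN] := ue _ e0; exists N => // n /= Nn.
have un := uN _ Nn; rewrite sub0r normrN ger0_norm ?fine_ge0//.
by rewrite -lee_fin fineK// ge0_fin_numE// (le_lt_trans un)// ltry.
Qed.

Section BochnerIntegral.
Context {d : measure_display} {T : measurableType d} {R : realType}.
Context {X : completeNormedModType R[i]}.
Variables (mu : {measure set T -> \bar R}) (D : set T).
Hypotheses (mD : measurable D) (muD : (mu D < +oo)%E).
Implicit Types (f g s : T -> X) (I : X).
Local Open Scope complex_scope.
Local Notation L1 f := (\int[mu]_(t in D) (rnorm (f t))%:E)%E.

Definition has_bochner_integral f I :=
  strongly_measurable mu D f /\ is_bochner_integral mu D f I.

Lemma simple_integral_approx_norm f s J e e' :
  strongly_measurable mu D f -> finitely_valued s ->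
  (L1 (f \- s) <= e%:E)%E -> rnorm (J - simple_integral mu D s) <= e' ->
  ((rnorm J)%:E <= L1 f + (e + e')%:E)%E.
Proof.
move=> sf fs fse Je'.
have H1 : ((rnorm (simple_integral mu D s))%:E <= L1 f + L1 (f \- s))%E.
  apply: (le_trans (rnorm_simple_integral mD muD fs)).
  apply: (L1_le mD muD) => //.
    apply: (strongly_measurableB mD muD) => //.
    exact: (strongly_measurable_simple mD muD).
  move=> t _ /=; have := rnorm_leB (f t) (f t - s t).
  by rewrite opprB addrC subrK.
rewrite EFinD addeA.
have : ((rnorm J)%:E <= (rnorm (simple_integral mu D s))%:E + e'%:E)%E.
  rewrite -EFinD lee_fin -lerBlDl (le_trans _ Je')//.
  by rewrite (le_trans _ (rnorm_dist _ _))// ler_norm.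
move=> /le_trans; apply; apply: leeD => //.
by apply: (le_trans H1); apply: leeD.
Qed.

Lemma has_bochner_integral_rnorm f I : has_bochner_integral f I ->
  ((rnorm I)%:E <= L1 f)%E.
Proof.
move=> [sf [s [[ss sfL1] sI]]]; apply/lee_addgt0Pr => e e0.
have /(ge0_cvg_ereal0P (fun n => L1_ge0 mu D _))/(_ (e / 2)) := sfL1.
rewrite divr_gt0// => /(_ isT)[N sN].
have /cvg_rnorm_seqP/(_ (e / 2)) := sI; rewrite divr_gt0// => /(_ isT)[M sM].
have := sM (maxn N M) (leq_maxr _ _); have := sN (maxn N M) (leq_maxl _ _).
set n := maxn N M => fn /ltW In.
rewrite [e in (_ + e%:E)%E]splitr.
apply: simple_integral_approx_norm fn In => //.
exact/(simple_funP mD muD).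
Qed.

Lemma has_bochner_integral_ae f g I : {ae mu, forall t, D t -> f t = g t} ->
  has_bochner_integral f I -> has_bochner_integral g I.
Proof.
move=> fg [sf [s [[ss sL1] sI]]]; split; first exact: strongly_measurable_ae sf.
exists s; split=> //; split=> //.
suff <- : (fun n => L1 (fun t => f t - s n t)) = (fun n => L1 (fun t => g t - s n t)).
  exact: sL1.
apply/funext => n; apply: L1_ae.
by apply: filterS fg => t fg Dt /=; rewrite fg.
Qed.

Lemma has_bochner_integralD f g I I' : has_bochner_integral f I ->
  has_bochner_integral g I' -> has_bochner_integral (f \+ g) (I + I').
Proof.
move=> [sf [s [[ss sL1] sI]]] [sg [s' [[ss' sL1'] sI']]].
split; first exact: (strongly_measurableD mD muD).
have fs n : finitely_valued (s n) by apply/(simple_funP mD muD).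
have fs' n : finitely_valued (s' n) by apply/(simple_funP mD muD).
exists (fun n => s n \+ s' n); split; last first.
  have -> : simple_integral mu D \o (fun n => s n \+ s' n) =
      fun n => simple_integral mu D (s n) + simple_integral mu D (s' n).
    by apply/funext => n /=; rewrite (simple_integralD mD muD).
  exact: cvgD.
split=> [n|].
  apply/(simple_funP mD muD).
  apply: (@finitely_valued_comp _ _ _ _ (fun t => (s n t, s' n t))
    (fun p : X * X => p.1 + p.2)).
  exact: finitely_valued_pair.
apply/ge0_cvg_ereal0P => [n|e e0]; first exact: L1_ge0.
have /(ge0_cvg_ereal0P (fun n => L1_ge0 mu D _))/(_ (e / 2)) := sL1.
rewrite divr_gt0// => /(_ isT)[N sN].
have /(ge0_cvg_ereal0P (fun n => L1_ge0 mu D _))/(_ (e / 2)) := sL1'.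
rewrite divr_gt0// => /(_ isT)[M sM].
exists (maxn N M) => n; rewrite geq_max => /andP[Nn Mn].
rewrite (splitr e) EFinD.
apply: le_trans (leeD (sN _ Nn) (sM _ Mn)).
apply: (L1_le mD muD (f := f \- s n) (g := g \- s' n)).
- apply: (strongly_measurableB mD muD) => //.
  exact: (strongly_measurable_simple mD muD).
- apply: (strongly_measurableB mD muD) => //.
  exact: (strongly_measurable_simple mD muD).
move=> t _ /=; apply: le_trans (rnorm_leD _ _).
by rewrite opprD addrACA.
Qed.

Lemma has_bochner_integralZ (c : R[i]) f I : has_bochner_integral f I ->
  has_bochner_integral (fun t => c *: f t) (c *: I).
Proof.
move=> [sf [s [[ss sL1] sI]]].
split; first exact: (strongly_measurableZ mD muD).
have fs n : finitely_valued (s n) by apply/(simple_funP mD muD).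
exists (fun n t => c *: s n t); split; last first.
  have -> : simple_integral mu D \o (fun n t => c *: s n t) =
      fun n => c *: simple_integral mu D (s n).
    by apply/funext => n /=; rewrite (simple_integralZ mD muD).
  exact: cvgZr.
split=> [n|].
  apply/(simple_funP mD muD).
  exact: (@finitely_valued_comp _ _ _ _ (s n) (fun x : X => c *: x)).
have -> : (fun n => \int[mu]_(t in D) (rnorm (c *: f t - c *: s n t))%:E)%E =
    (fun n => (cmod c)%:E *
      \int[mu]_(t in D) (rnorm (f t - s n t))%:E)%E.
  apply/funext => n; rewrite -(@L1Z _ _ _ _ mu D mD muD c (f \- s n)).
    by apply: eq_integral => t _; rewrite scalerBr.
  apply: (strongly_measurableB mD muD) => //.
  exact: (strongly_measurable_simple mD muD).
by rewrite -[X in _ --> X](mule0 (cmod c)%:E); apply: cvgeZl.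
Qed.

Lemma has_bochner_integralB f g I I' : has_bochner_integral f I ->
  has_bochner_integral g I' -> has_bochner_integral (f \- g) (I - I').
Proof.
move=> fI /(has_bochner_integralZ (-1)) gI.
have := has_bochner_integralD fI gI; rewrite scaleN1r.
by congr has_bochner_integral; apply/funext => t /=; rewrite scaleN1r.
Qed.

Lemma has_bochner_integral_simple s : finitely_valued s ->
  has_bochner_integral s (simple_integral mu D s).
Proof.
move=> fs; split; first exact: (strongly_measurable_simple mD muD).
exists (fun=> s); split; last exact: cvg_cst.
split=> [_|]; first exact/(simple_funP mD muD).
under eq_fun do under eq_integral do rewrite subrr rnorm0.
by rewrite integral0; exact: cvg_cst.
Qed.

Lemma has_bochner_integral_unique f I I' :
  has_bochner_integral f I -> has_bochner_integral f I' -> I = I'.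
Proof.
move=> fI fI'; apply/eqP; rewrite -subr_eq0; apply/eqP; apply: rnorm0_eq0.
apply/eqP; rewrite eq_le rnorm_ge0 andbT -lee_fin.
apply: (le_trans (has_bochner_integral_rnorm (has_bochner_integralB fI fI'))).
rewrite le_eqVlt; apply/orP; left; apply/eqP.
by under eq_integral do rewrite /= subrr rnorm0; rewrite integral0.
Qed.

Lemma bochner_integrableP f :
  bochner_integrable mu D f <-> exists I, has_bochner_integral f I.
Proof.
split=> [[sf [s [ss sL1]]]|[I [sf [s [sa _]]]]]; last by split=> //; exists s.
have fs n : finitely_valued (s n) by apply/(simple_funP mD muD).
suff [I sI] : exists I : X, simple_integral mu D \o s @ \oo --> I.
  by exists I; split=> //; exists s.
apply: rnorm_complete => e e0.
have /(ge0_cvg_ereal0P (fun n => L1_ge0 mu D _))/(_ (e / 3)) := sL1.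
rewrite divr_gt0// => /(_ isT)[N sN]; exists N => m n Nm Nn /=.
rewrite -lte_fin; apply: (@le_lt_trans _ _ ((e / 3)%:E + (e / 3)%:E)%E); last first.
  by rewrite -EFinD lte_fin; lra.
apply: le_trans (leeD (sN _ Nm) (sN _ Nn)).
have fI k := has_bochner_integral_simple (fs k).
apply: (le_trans (has_bochner_integral_rnorm (has_bochner_integralB (fI m) (fI n)))).
have sfs k : strongly_measurable mu D (f \- s k).
  by apply: (strongly_measurableB mD muD) => //; case: (fI k).
apply: (L1_le mD muD (sfs m) (sfs n)) => t _ /=.
by rewrite -(subrKA (f t)) (rnormB (f t) (s m t)) rnorm_leD.
Qed.

Lemma bochner_integralE f I :
  has_bochner_integral f I -> bochner_integral mu D f = I.
Proof.
move=> fI; rewrite /bochner_integral.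
case: xgetP => [I' _ /= fI'|/(_ I)]; last by case: fI.
by apply: (has_bochner_integral_unique _ fI); split=> //; case: fI.
Qed.

End BochnerIntegral.

Section Restriction.
Context {d : measure_display} {T : measurableType d} {R : realType}.
Context {X : completeNormedModType R[i]}.
Variable (mu : {measure set T -> \bar R}).
Implicit Types (f g s : T -> X) (I : X) (D : set T).

Lemma L1_extend D D' f : D `<=` D' ->
  (\int[mu]_(t in D') (rnorm (if t \in D then f t else 0))%:E =
   \int[mu]_(t in D) (rnorm (f t))%:E)%E.
Proof.
move=> DD'; rewrite integral_mkcond [RHS]integral_mkcond.
apply: eq_integral => t _; rewrite !patchE.
have [tD|tD] := boolP (t \in D).
  by rewrite ifT//; apply/mem_set/DD'/set_mem.
by rewrite rnorm0; case: ifP.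
Qed.

Lemma L1_le_subset D D' f : measurable D -> measurable D' -> D `<=` D' ->
  (\int[mu]_(t in D) (rnorm (f t))%:E <= \int[mu]_(t in D') (rnorm (f t))%:E)%E.
Proof.
move=> mD mD' DD'; rewrite -(L1_extend _ DD').
apply: ge0_ae_le_integral => // [t _|t _|]; rewrite ?lee_fin ?rnorm_ge0//.
apply: aeW => t _; rewrite lee_fin; case: ifP => //.
by rewrite rnorm0 rnorm_ge0.
Qed.

Lemma strongly_measurable_subset D D' f : measurable D' -> D `<=` D' ->
  measurable D -> (mu D' < +oo)%E ->
  strongly_measurable mu D' f -> strongly_measurable mu D f.
Proof.
move=> mD' DD' mD muD' [s [ss sf]].
have muD : (mu D < +oo)%E.
  by apply: (le_lt_trans _ muD'); apply: le_measure; rewrite ?inE.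
exists s; split=> [n|].
  exact/(simple_funP mD muD)/(simple_funP mD' muD').
by apply: filterS sf => t sf /DD'; exact: sf.
Qed.

Lemma has_bochner_integral_extend D D' f I :
  measurable D -> measurable D' -> (mu D' < +oo)%E -> D `<=` D' ->
  has_bochner_integral mu D f I ->
  has_bochner_integral mu D' (fun t => if t \in D then f t else 0) I.
Proof.
move=> mD mD' muD' DD' [[u [us uf]] [s [[ss sL1] sI]]].
have muD : (mu D < +oo)%E.
  by apply: (le_lt_trans _ muD'); apply: le_measure; rewrite ?inE.
have fp (v : T -> X) : simple_fun mu D v -> finitely_valued (fun t => (v t, t \in D)).
  move=> /(simple_funP mD muD) fv.
  by apply: finitely_valued_pair => //; exact: finitely_valued_mem.
have fc (v : T -> X) : simple_fun mu D v ->
    simple_fun mu D' (fun t => if t \in D then v t else 0).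
  move=> vs; apply/(simple_funP mD' muD').
  exact: (finitely_valued_comp (fun p : X * bool => if p.2 then p.1 else 0) (fp _ vs)).
split.
  exists (fun n t => if t \in D then u n t else 0); split=> [n|]; first exact: fc.
  apply: filterS uf => t uf _; case: ifPn => [/set_mem/uf//|_].
  exact: cvg_cst.
exists (fun n t => if t \in D then s n t else 0); split; [split=> [n|]|].
- exact: fc.
- suff -> : (fun n => \int[mu]_(t in D') (rnorm
      ((if t \in D then f t else 0) - (if t \in D then s n t else 0)))%:E)%E =
      (fun n => \int[mu]_(t in D) (rnorm (f t - s n t))%:E)%E by [].
  apply/funext => n; rewrite -(L1_extend (f \- s n) DD').
  by apply: eq_integral => t _; case: ifP => // _; rewrite subrr.
suff -> : simple_integral mu D' \o (fun n t => if t \in D then s n t else 0) =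
    simple_integral mu D \o s by [].
apply/funext => n /=.
rewrite (simple_integral_comp mD' muD'
  (fun p : X * bool => if p.2 then p.1 else 0) (fp _ (ss n))).
rewrite (simple_integral_comp mD muD (fun p : X * bool => p.1) (fp _ (ss n))).
apply: eq_fsbigr => -[x [|]] _ /=.
  congr (_%:C%C *: _); congr (fine (mu _)).
  apply/seteqP; split=> t [Dt /= -[sx tD]]; split=> //=.
  - exact: set_mem.
  - by rewrite sx tD.
  - exact: DD'.
  - by rewrite sx tD.
rewrite scaler0 (_ : D `&` _ = set0) ?measure0 ?scale0r//.
by apply/seteqP; split=> // t [/mem_set Dt /= [_]]; rewrite Dt.
Qed.

End Restriction.

Section MeasurePreserving.
Context {d : measure_display} {T : measurableType d} {R : realType}.
Context {X : completeNormedModType R[i]}.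
Variables (mu : {measure set T -> \bar R}) (theta : T -> T).
Hypotheses (mtheta : measurable_fun setT theta)
  (surj_theta : forall t, exists t', theta t' = t)
  (mu_theta : forall A, measurable A -> mu (theta @^-1` A) = mu A).
Implicit Types (f g s : T -> X) (I : X) (D : set T).

Let measurable_preimage A : measurable A -> measurable (theta @^-1` A).
Proof. by move=> mA; rewrite -[X in measurable X]setTI; exact: mtheta. Qed.

Lemma ae_preimage (P : T -> Prop) :
  {ae mu, forall t, P t} -> {ae mu, forall t, P (theta t)}.
Proof.
move=> [N [mN N0 PN]]; exists (theta @^-1` N); split.
- exact: measurable_preimage.
- by rewrite mu_theta.
- by move=> t /= Pt; apply: PN.
Qed.

Lemma L1_preimage D f : measurable D -> (mu D < +oo)%E ->
  strongly_measurable mu D f ->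
  (\int[mu]_(t in theta @^-1` D) (rnorm (f (theta t)))%:E =
   \int[mu]_(t in D) (rnorm (f t))%:E)%E.
Proof.
move=> mD muD /(strongly_measurable_rnorm mD muD)[h mh [h0 fh]].
transitivity (\int[mu]_(t in theta @^-1` D) (h (theta t))%:E)%E.
  apply: ge0_ae_eq_integral_nonmeasurable.
  - by move=> t _; rewrite lee_fin rnorm_ge0.
  - by move=> t _; rewrite lee_fin.
  by have := ae_preimage fh; apply: filterS => t fE Dt; rewrite fE.
transitivity (\int[mu]_(t in D) (h t)%:E)%E; last first.
  apply/esym/ge0_ae_eq_integral_nonmeasurable => //.
  - by move=> t _; rewrite lee_fin rnorm_ge0.
  - by move=> t _; rewrite lee_fin.
  by apply: filterS fh => t fE Dt; rewrite fE.
have := @ge0_integral_pushforward _ _ _ _ _ theta mtheta mu D (EFin \o h).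
move=> <-//; last 2 first.
- by apply/measurable_EFinP; exact: measurable_funTS.
- by move=> t _; rewrite lee_fin.
apply: eq_measure_integral => A mA AD.
exact: mu_theta.
Qed.

Lemma has_bochner_integral_preimage D f I : measurable D -> (mu D < +oo)%E ->
  has_bochner_integral mu D f I ->
  has_bochner_integral mu (theta @^-1` D) (f \o theta) I.
Proof.
move=> mD muD [[u [us uf]] [s [[ss sL1] sI]]].
have mtD : measurable (theta @^-1` D) by exact: measurable_preimage.
have mutD : (mu (theta @^-1` D) < +oo)%E by rewrite mu_theta.
have rE (v : T -> X) : range (v \o theta) = range v :> set X.
  apply/seteqP; split=> [_ [t _ <-]|_ [t _ <-]]; first by exists (theta t).
  by have [t' <-] := surj_theta t; exists t'.
have fc (v : T -> X) : simple_fun mu D v -> simple_fun mu (theta @^-1` D) (v \o theta).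
  move=> /(simple_funP mD muD)[fv mv]; apply/(simple_funP mtD mutD); split.
    by rewrite rE.
  by move=> i; rewrite comp_preimage; exact: measurable_preimage.
split.
  exists (fun n => u n \o theta); split=> [n|]; first exact: fc.
  exact: (ae_preimage uf).
exists (fun n => s n \o theta); split; [split=> [n|]|].
- exact: fc.
- suff -> : (fun n => \int[mu]_(t in theta @^-1` D)
      (rnorm ((f \o theta) t - (s n \o theta) t))%:E)%E =
      (fun n => \int[mu]_(t in D) (rnorm (f t - s n t))%:E)%E by [].
  apply/funext => n; rewrite -(@L1_preimage D (f \- s n))//.
  apply: (strongly_measurableB mD muD); first by exists u.
  exact/(strongly_measurable_simple mD muD)/(simple_funP mD muD).
suff -> : simple_integral mu (theta @^-1` D) \o (fun n => s n \o theta) =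
    simple_integral mu D \o s by [].
apply/funext => n /=; rewrite /simple_integral rE; apply: eq_fsbigr => x _.
congr (_%:C%C *: _); congr fine.
rewrite comp_preimage -preimage_setI mu_theta//; apply: measurableI => //.
by have [] := ss n.
Qed.

End MeasurePreserving.

(** * Bochner integrals over intervals *)

Section Shift.
Context {R : realType}.
Local Notation mu := (@lebesgue_measure R).
Implicit Types (c h k : R).

Lemma measurable_shift c :
  measurable_fun setT (fun s : measurableTypeR R => c + s : measurableTypeR R).
Proof. by apply: measurable_funD => //; exact: measurable_cst. Qed.

Lemma lebesgue_measure_shift c (A : set R) : measurable A ->
  mu ((fun s => c + s) @^-1` A) = mu A.
Proof.
move=> mA.
have := @lebesgue_measure_unique R
  (measure_function_pushforward__canonical__measure_function_Measure mu
    (measurable_shift c)).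
move=> /(_ _ A mA)/= H; rewrite [RHS]H; [by []|] => {H} _ [[a b] _ <-].
rewrite /pushforward.
suff -> : (fun s => c + s) @^-1` `]a, b] = `]a - c, b - c]%classic.
  rewrite !lebesgue_measure_itv/= !lte_fin ltrD2r; case: ifPn => // ab.
  by rewrite -!EFinB; congr EFin; ring.
by apply/seteqP; split=> s /=; rewrite !in_itv/= => /andP[? ?]; apply/andP; split; lra.
Qed.

Lemma lebesgue_shift_surj c (t : R) : exists s, c + s = t.
Proof. by exists (t - c); ring. Qed.

Lemma ae_shift c (P : R -> Prop) :
  {ae mu, forall t, P t} -> {ae mu, forall t, P (c + t)}.
Proof.
by move/(ae_preimage (measurable_shift c) (@lebesgue_measure_shift c)).
Qed.

Lemma ae_imply (P Q : R -> Prop) : (forall t, P t -> Q t) ->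
  {ae mu, forall t, P t} -> {ae mu, forall t, Q t}.
Proof.
move=> PQ [N [mN N0 PN]]; exists N; split=> // t /= Qt.
by apply: PN => /= /PQ.
Qed.

Lemma ae_and (P Q : R -> Prop) : {ae mu, forall t, P t} ->
  {ae mu, forall t, Q t} -> {ae mu, forall t, P t /\ Q t}.
Proof.
move=> [N [mN N0 PN]] [M [mM M0 QM]]; exists (N `|` M); split.
- exact: measurableU.
- exact: null_set_setU.
move=> t /= PQ; apply: contrapT => /not_orP[Nt Mt]; apply: PQ.
by split; apply: contrapT => H; [apply: Nt; apply: PN|apply: Mt; apply: QM].
Qed.

End Shift.

Section IntervalIntegral.
Context {R : realType} {X : completeNormedModType R[i]}.
Local Notation mu := (@lebesgue_measure R).
Implicit Types (c h k : R) (f : R -> X).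

Lemma lebesgue_measure_itvcc h k : h <= k -> mu `[h, k] = (k - h)%:E.
Proof.
move=> hk; rewrite lebesgue_measure_itv/= lte_fin.
by case: ltgtP hk => // -> _; rewrite subrr.
Qed.

Lemma lebesgue_measure_itvcc_lty h k : (mu `[h, k] < +oo)%E.
Proof.
rewrite lebesgue_measure_itv/=; case: ifP => // _.
by rewrite -EFinB ltry.
Qed.

Lemma has_bochner_integral_shift c (E : set R) f (I : X) :
  measurable E -> (mu E < +oo)%E -> has_bochner_integral mu E f I ->
  has_bochner_integral mu ((fun s => c + s) @^-1` E) (fun s => f (c + s)) I.
Proof.
move=> mE muE fI.
exact: (@has_bochner_integral_preimage _ _ _ _ mu _ (measurable_shift c)
  (@lebesgue_shift_surj R c) (@lebesgue_measure_shift R c) _ _ _ mE muE fI).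
Qed.

Lemma preimage_shift_itvcc c h k :
  (fun s => c + s) @^-1` `[h, k] = `[h - c, k - c]%classic.
Proof.
by apply/seteqP; split=> s /=; rewrite !in_itv/= => /andP[? ?]; apply/andP; split; lra.
Qed.

Lemma has_bochner_integral_itvD h k f (I I' : X) : 0 <= h -> 0 <= k ->
  has_bochner_integral mu `[0, h] f I ->
  has_bochner_integral mu `[0, k] (fun s => f (h + s)) I' ->
  has_bochner_integral mu `[0, h + k] f (I + I').
Proof.
move=> h0 k0 fI.
move=> /(has_bochner_integral_shift (- h) (measurable_itv _)
  (lebesgue_measure_itvcc_lty _ _)).
rewrite preimage_shift_itvcc sub0r opprK (addrC k).
have -> : (fun s => f (h + (- h + s))) = f by apply/funext => s; rewrite addNKr.
move=> fI'.
have mhk := measurable_itv `[0, h + k].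
have fhk := lebesgue_measure_itvcc_lty 0 (h + k).
have sub1 : `[0, h] `<=` `[0, h + k].
  by move=> s /=; rewrite !in_itv/= => /andP[? ?]; apply/andP; split; lra.
have sub2 : `[h, h + k] `<=` `[0, h + k].
  by move=> s /=; rewrite !in_itv/= => /andP[? ?]; apply/andP; split; lra.
have fI1 := has_bochner_integral_extend (mu := mu) (measurable_itv _) mhk fhk sub1 fI.
have fI2 := has_bochner_integral_extend (mu := mu) (measurable_itv _) mhk fhk sub2 fI'.
apply: has_bochner_integral_ae (has_bochner_integralD (mu := mu) mhk fhk fI1 fI2).
exists [set h]; split=> //; first exact: lebesgue_measure_set1.
move=> t /= Ht; apply: contrapT => /eqP th; apply: Ht.
rewrite in_itv/= => /andP[t0 thk]; case: (ltgtP t h) th => // th _.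
- rewrite mem_set/=; last by rewrite in_itv/= t0 ltW.
  by rewrite memNset/= ?addr0// in_itv/= leNgt th.
- rewrite memNset/=; last by rewrite in_itv/= t0/= leNgt th.
  by rewrite mem_set/= ?add0r// in_itv/= ltW.
Qed.

Lemma has_bochner_integral_cst (D : set R) (x : X) :
  measurable D -> (mu D < +oo)%E ->
  has_bochner_integral mu D (fun=> x) ((fine (mu D))%:C%C *: x).
Proof.
move=> mD muD; have fx := @finitely_valued_cst _ (measurableTypeR R) X x.
have := has_bochner_integral_simple (mu := mu) mD muD fx.
congr has_bochner_integral; rewrite /simple_integral.
have -> : range (fun _ : measurableTypeR R => x) = [set x].
  by apply/seteqP; split=> [_ [t _ <-] //|_ ->]; exists 0.
by rewrite fsbig_set1 preimage_cst mem_set// setIT.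
Qed.

Lemma has_bochner_integral_bound (D : set R) f (I : X) (C : R) :
  measurable D -> (mu D < +oo)%E -> 0 <= C ->
  has_bochner_integral mu D f I -> (forall t, D t -> rnorm (f t) <= C) ->
  rnorm I <= C * fine (mu D).
Proof.
move=> mD muD C0 fI fC; rewrite -lee_fin.
apply: (le_trans (has_bochner_integral_rnorm (mu := mu) mD muD fI)).
rewrite EFinM fineK ?ge0_fin_numE// -integral_cst//.
apply: ge0_ae_le_integral.
- by move=> t _; rewrite lee_fin rnorm_ge0.
- by move=> t _; rewrite lee_fin.
by apply: aeW => t Dt; rewrite lee_fin fC.
Qed.

End IntervalIntegral.

Section ContinuousFunctions.
Context {R : realType} {X : normedModType R[i]}.
Implicit Types (f : R -> X).

Lemma continuous_rnormP f :
  continuous f <-> forall t e, 0 < e ->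
    exists2 d, 0 < d & forall s, `|s - t| < d -> rnorm (f s - f t) < e.
Proof.
split=> [cf t e e0|cf t].
  have /cvg_rnormP/(_ e e0)[d /= d0 fd] := cf t.
  by exists d => // s st; rewrite rnormB; apply: fd; rewrite /= distrC.
apply/cvg_rnormP => e e0; have [d d0 fd] := cf t e e0.
by exists d => //= s st; rewrite rnormB fd// distrC.
Qed.

Lemma continuous_uniform_itvcc f (a b e : R) : continuous f -> 0 < e ->
  exists2 d, 0 < d & forall t s, a <= t <= b -> `|s - t| < d ->
    rnorm (f s - f t) < e.
Proof.
move=> /continuous_rnormP cf e0.
have : compact `[a, b] by exact: segment_compact.
move=> /compact_near_coveringP/(_ R (0^'+)
  (fun d t => forall s, `|s - t| < d -> rnorm (f s - f t) < e)).
case=> [t _|d /= d0 fd].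
  have [d d0 fd] := cf t (e / 2) ltac:(by rewrite divr_gt0).
  exists ([set t' | `|t - t'| < d / 2], [set d' | d' < d / 2]) => /=.
    split; first by exists (d / 2) => //=; rewrite divr_gt0.
    by apply: nbhs_right_lt; rewrite divr_gt0.
  move=> [t' d'] /= [tt' d'd] s st'.
  have -> : f s - f t' = (f s - f t) - (f t' - f t) by rewrite opprB addrA subrK.
  apply: (le_lt_trans (rnorm_leB _ _)); rewrite (splitr e) ltrD// fd//.
    rewrite -(subrK t' s) -addrA (le_lt_trans (ler_normD _ _))//.
    by rewrite (splitr d) ltrD// ?(lt_trans st')// distrC.
  by rewrite distrC (lt_le_trans tt')//; lra.
exists (d / 2); first by rewrite divr_gt0.
move=> t s atb st; apply: (fd (d / 2)) => //=.
- by rewrite sub0r normrN gtr0_norm ?divr_gt0//; lra.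
- by rewrite divr_gt0.
Qed.

End ContinuousFunctions.

Section ContinuousIntegrable.
Context {R : realType} {X : completeNormedModType R[i]}.
Local Notation mu := (@lebesgue_measure R).
Implicit Types (f : R -> X).

Lemma floor_finitely_valued (N : R) (n : nat) :
  finitely_valued (fun t : measurableTypeR R =>
    Num.floor (n.+1%:R * Num.max (- N) (Num.min N t))).
Proof.
have maxN (x : R) : Num.max (- N) (Num.min N x) <= Num.max (- N) N.
  by rewrite ge_max !le_max le_refl !ge_min le_refl !orbT.
have Nmax (x : R) : - N <= Num.max (- N) (Num.min N x) by rewrite le_max le_refl.
set phi : measurableTypeR R -> R := fun t => n.+1%:R * Num.max (- N) (Num.min N t).
have mphi : measurable_fun setT phi.
  apply: measurable_funM; first exact: measurable_cst.
  apply: measurable_maxr; first exact: measurable_cst.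
  by apply: measurable_minr => //; exact: measurable_cst.
split.
  pose M := Num.floor (n.+1%:R * Num.max (- N) N).
  pose m := Num.floor (n.+1%:R * - N).
  apply: (@sub_finite_set _ _ [set m + k%:Z | k in `I_(`|M - m|%N.+1)]).
    move=> _ [t _ <-].
    have mt : m <= Num.floor (phi t).
      by apply: le_floor; rewrite ler_wpM2l// Nmax.
    have tM : Num.floor (phi t) <= M.
      by apply: le_floor; rewrite ler_wpM2l//.
    exists `|Num.floor (phi t) - m|%N.
      rewrite /= ltnS -lez_nat !gez0_abs ?subr_ge0 ?lerD2r//.
      exact: le_trans tM.
    by rewrite gez0_abs ?subr_ge0// addrCA subrr addr0.
  exact/finite_image/finite_II.
move=> i.
rewrite (_ : _ @^-1` _ = phi @^-1` `[i%:~R, (i + 1)%:~R[).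
  by rewrite -[X in measurable X]setTI; exact: mphi.
apply/seteqP; split=> t /=; rewrite in_itv/=.
  by move=> <-; exact: real_floor_itv (num_real _).
exact: floor_def.
Qed.

Lemma continuous_bochner_integrable f (K : set R) :
  continuous f -> compact K -> bochner_integrable mu K f.
Proof.
move=> cf cK; have mK := compact_measurable cK.
have [N N0 KN] : exists2 N : R, 0 < N & forall t, K t -> - N <= t <= N.
  have [M [Mr KM]] := compact_bounded cK.
  exists (`|M| + 1); first by rewrite ltr_wpDl.
  move=> t Kt; rewrite -ler_norml; apply: KM => //.
  by rewrite (le_lt_trans (ler_norm _))// ltrDl.
have muK : (mu K < +oo)%E.
  apply: (le_lt_trans _ (lebesgue_measure_itvcc_lty (- N) N)).
  by apply: le_measure; rewrite ?inE// => t /KN; rewrite /= in_itv.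
pose phi (n : nat) (t : measurableTypeR R) :=
  Num.floor (n.+1%:R * Num.max (- N) (Num.min N t)).
pose s n (t : measurableTypeR R) := f ((phi n t)%:~R / n.+1%:R).
have fs n : finitely_valued (s n).
  exact: (finitely_valued_comp (fun i : int => f (i%:~R / n.+1%:R))
    (floor_finitely_valued N n)).
have sf e : 0 < e -> exists M, forall n, (M <= n)%N -> forall t, K t ->
    rnorm (f t - s n t) < e.
  move=> e0; have [d d0 fd] := continuous_uniform_itvcc (- N) N cf e0.
  exists (Num.truncn d^-1) => n Mn t Kt; rewrite rnormB; apply: fd; first exact: KN.
  rewrite /phi; have -> : Num.max (- N) (Num.min N t) = t.
    by have /andP[? ?] := KN _ Kt; rewrite min_r// max_r.
  have n0 : 0 < n.+1%:R :> R by [].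
  have /andP[] := real_floor_itv (num_real (n.+1%:R * t)).
  set i := Num.floor _ => it ti.
  have dn : n.+1%:R^-1 < d.
    rewrite invf_plt ?posrE// (lt_le_trans (truncnS_gt _))//.
    by rewrite ler_nat ltnS.
  apply: le_lt_trans dn; rewrite distrC ger0_norm; last first.
    by rewrite subr_ge0 ler_pdivrMr// mulrC.
  rewrite lerBlDl -[X in _ <= _ + X]div1r -mulrDl ler_pdivlMr// mulrC ltW//.
  by rewrite (lt_le_trans ti)// intrD.
split.
  exists s; split=> [n|]; first exact/(simple_funP (mu := mu) mK muK).
  apply: aeW => t Kt; apply/cvg_rnorm_seqP => e /sf[M fM].
  by exists M => n Mn; apply: fM.
exists s; split=> [n|]; first exact/(simple_funP (mu := mu) mK muK).
apply/ge0_cvg_ereal0P => [n|e e0]; first exact: L1_ge0.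
have m0 : 0 <= fine (mu K) by rewrite fine_ge0.
have [|M fM] := sf (e / (fine (mu K) + 1)).
  by rewrite divr_gt0// ltr_wpDl.
exists M => n Mn.
apply: (@le_trans _ _ (\int[mu]_(t in K) (e / (fine (mu K) + 1))%:E)%E).
  apply: ge0_ae_le_integral.
  - by move=> t _; rewrite lee_fin rnorm_ge0.
  - by move=> t _; rewrite lee_fin divr_ge0// ltW// ltr_wpDl.
  by apply: aeW => t Kt; rewrite lee_fin ltW// fM.
have muE : mu K = (fine (mu K))%:E by rewrite fineK// ge0_fin_numE.
rewrite integral_cst// [X in (_ * X <= _)%E]muE.
rewrite -EFinM lee_fin mulrAC ler_pdivrMr ?ltr_wpDl//.
by rewrite ler_wpM2l ?(ltW e0)// lerDl.
Qed.

End ContinuousIntegrable.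

Section LocalIntegrals.
Context {R : realType} {X : completeNormedModType R[i]}.
Local Notation mu := (@lebesgue_measure R).
Implicit Types (f : R -> X).

Lemma finitely_valued_bounded (s : measurableTypeR R -> X) : finitely_valued s ->
  exists2 C : R, 0 <= C & forall t, rnorm (s t) <= C.
Proof.
move=> [/finite_seqP[r rE] _]; exists (\sum_(x <- r) rnorm x).
  by apply: sumr_ge0 => x _; exact: rnorm_ge0.
move=> t; have st : s t \in r.
  by have : range s (s t) by [exists t]; rewrite rE.
rewrite (big_rem _ st)/= lerDl; apply: sumr_ge0 => x _; exact: rnorm_ge0.
Qed.

Lemma L1_bound (D : set R) f (C : R) : measurable D -> (mu D < +oo)%E ->
  (forall t, D t -> rnorm (f t) <= C) -> 0 <= C ->
  (\int[mu]_(t in D) (rnorm (f t))%:E <= (C * fine (mu D))%:E)%E.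
Proof.
move=> mD muD fC C0.
rewrite EFinM fineK ?ge0_fin_numE// -integral_cst//.
apply: ge0_ae_le_integral.
- by move=> t _; rewrite lee_fin rnorm_ge0.
- by move=> t _; rewrite lee_fin.
by apply: aeW => t Dt; rewrite lee_fin fC.
Qed.

Lemma bochner_integrable_simple_approx (D : set R) f e :
  measurable D -> (mu D < +oo)%E -> bochner_integrable mu D f -> 0 < e ->
  exists s : measurableTypeR R -> X, finitely_valued s /\
    (\int[mu]_(t in D) (rnorm (f t - s t))%:E <= e%:E)%E.
Proof.
move=> mD muD [_ [s [ss sL1]]] e0.
have /(ge0_cvg_ereal0P (fun n => L1_ge0 mu D _))/(_ e e0)[N sN] := sL1.
exists (s N); split; last exact: sN.
exact/(simple_funP (mu := mu) mD muD).
Qed.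

Lemma bochner_integral_itv_small f (a b e : R) :
  bochner_integrable mu `[a, b] f -> 0 < e ->
  exists2 d, 0 < d & forall t x I, a <= t -> 0 <= x <= d -> t + x <= b ->
    has_bochner_integral mu `[0, x] (fun s => f (t + s)) I -> rnorm I <= e.
Proof.
move=> fI e0; have mab := measurable_itv `[a, b].
have muab := lebesgue_measure_itvcc_lty a b.
have e20 : 0 < e / 2 by rewrite divr_gt0.
have [s [fs sf]] := bochner_integrable_simple_approx mab muab fI e20.
have [C C0 sC] := finitely_valued_bounded fs.
exists (e / 2 / (C + 1)); first by rewrite divr_gt0// ltr_wpDl.
move=> t x I at_ /andP[x0 xd] txb.
move=> /(has_bochner_integral_shift (- t) (measurable_itv _)
  (lebesgue_measure_itvcc_lty _ _)).
rewrite preimage_shift_itvcc sub0r opprK (addrC x).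
have -> : (fun s => f (t + (- t + s))) = f by apply/funext => u; rewrite addNKr.
move=> fIt; have mt := measurable_itv `[t, t + x].
have mut := lebesgue_measure_itvcc_lty t (t + x).
have sub : `[t, t + x] `<=` `[a, b].
  by move=> u /=; rewrite !in_itv/= => /andP[? ?]; apply/andP; split; lra.
have sfs : strongly_measurable mu `[t, t + x] (f \- s).
  apply: (strongly_measurableB (mu := mu) mt mut); first by case: fIt.
  exact: (strongly_measurable_simple (mu := mu) mt mut).
have ss : strongly_measurable mu `[t, t + x] s.
  exact: (strongly_measurable_simple (mu := mu) mt mut).
rewrite -lee_fin (le_trans (has_bochner_integral_rnorm (mu := mu) mt mut fIt))//.
apply: (le_trans (L1_le (mu := mu) mt mut (h := f) sfs ss _)).
  by move=> u _ /=; rewrite -[X in rnorm X <= _](subrK (s u)) rnorm_leD.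
rewrite (splitr e) EFinD leeD//.
  by apply: (le_trans (L1_le_subset mu (f \- s) mt mab sub)).
apply: (le_trans (L1_bound mt mut (fun u _ => sC u) C0)).
rewrite lee_fin lebesgue_measure_itvcc ?lerDl//= addrAC subrr add0r.
apply: (@le_trans _ _ (C * (e / 2 / (C + 1)))); first by rewrite ler_wpM2l.
rewrite mulrA ler_pdivrMr ?ltr_wpDl// mulrC ler_wpM2l ?(ltW e20)//.
by rewrite lerDl.
Qed.

Lemma bochner_integrable_L1_lty (D : set R) f :
  measurable D -> (mu D < +oo)%E -> bochner_integrable mu D f ->
  (\int[mu]_(t in D) (rnorm (f t))%:E < +oo)%E.
Proof.
move=> mD muD fI; have [sf _] := fI.
have [s [fs sf1]] := bochner_integrable_simple_approx mD muD fI ltr01.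
have [C C0 sC] := finitely_valued_bounded fs.
have ss : strongly_measurable mu D s.
  exact: (strongly_measurable_simple (mu := mu) mD muD).
have sfs : strongly_measurable mu D (f \- s).
  exact: (strongly_measurableB (mu := mu) mD muD).
apply: (@le_lt_trans _ _ (1 + (C * fine (mu D)))%:E); last exact: ltry.
apply: (le_trans (L1_le (mu := mu) mD muD (h := f) sfs ss _)).
  by move=> u _ /=; rewrite -[X in rnorm X <= _](subrK (s u)) rnorm_leD.
by rewrite EFinD leeD//; exact: (L1_bound mD muD (fun u _ => sC u) C0).
Qed.

Lemma rnorm_lebesgue_differentiation f (a b : R) (x : X) :
  bochner_integrable mu `[a, b] f ->
  {ae mu, forall t, a <= t < b ->
    (fun n => n.+1%:R%:E *
      \int[mu]_(s in `[t, (t + n.+1%:R^-1)%R]) (rnorm (f s - x))%:E)%E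
    @ \oo --> (rnorm (f t - x))%:E}.
Proof.
move=> fI; have mab := measurable_itv `[a, b].
have muab := lebesgue_measure_itvcc_lty a b.
have gI : bochner_integrable mu `[a, b] (fun s => f s - x).
  have [I fI'] := (bochner_integrableP (mu := mu) mab muab _).1 fI.
  apply/(bochner_integrableP (mu := mu) mab muab).
  exists (I - (fine (mu `[a, b]))%:C%C *: x).
  apply: (has_bochner_integralB (mu := mu) mab muab fI').
  exact: has_bochner_integral_cst.
have gL1 := bochner_integrable_L1_lty mab muab gI.
have [h mh [h0 gh]] := strongly_measurable_rnorm (mu := mu) mab muab (proj1 gI).
pose H t := h t * \1_`[a, b] t.
have H0 t : 0 <= H t by rewrite mulr_ge0// indicE.
have mH : measurable_fun setT H.
  by apply: measurable_funM => //; exact: measurable_indic.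
have locH : locally_integrable setT H.
  split=> [//||K _ cK]; first exact: openT.
  apply: le_lt_trans gL1.
  have -> : (\int[mu]_(t in `[a, b]) (rnorm (f t - x))%:E =
      \int[mu]_(t in `[a, b]) (h t)%:E)%E.
    apply: ge0_ae_eq_integral_nonmeasurable.
    - by move=> t _; rewrite lee_fin rnorm_ge0.
    - by move=> t _; rewrite lee_fin.
    by apply: filterS gh => t gh Dt; rewrite gh.
  rewrite integral_mkcond [leRHS]integral_mkcond.
  apply: ge0_ae_le_integral.
  - by move=> t _; rewrite patchE; case: ifP => //; rewrite lee_fin.
  - by move=> t _; rewrite patchE; case: ifP => //; rewrite lee_fin.
  apply: aeW => t _; rewrite !patchE ger0_norm// /H indicE.
  by case: ifP => _; case: ifP => _; rewrite ?mulr1 ?mulr0 ?lee_fin.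
have gh' := gh; have := lebesgue_differentiation locH; move: gh.
apply: filterS2 => t gh lH /andP[at_ tb].
pose E (y : R) (n : nat) := `[y, y + n.+1%:R^-1]%classic.
have muE y n : mu (E y n) = (n.+1%:R^-1)%:E.
  by rewrite lebesgue_measure_itvcc ?lerDl// addrAC subrr add0r.
have n0 n : 0 < n.+1%:R^-1 :> R by rewrite invr_gt0.
have nice_E y : nicely_shrinking y (E y).
  split=> [n|]; first exact: measurable_itv.
  have r0 k : 0 < 2 * k.+1%:R^-1 :> R by rewrite mulr_gt0.
  exists (4, fun n => PosNum (r0 n)); split => //= [|k z|k].
  - rewrite -(mulr0 2); apply: cvgMr; exact: cvg_harmonic.
  - rewrite /E/= in_itv/= /ball/= ltr_distlC => /andP[yz zy].
    by have := n0 k; set u := _^-1 in zy *; move=> ?; apply/andP; split; lra.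
  - rewrite lebesgue_measure_ball ?(ltW (r0 k))// muE -EFinM lee_fin.
    by have := n0 k; set u := _^-1; rewrite mulr2n; lra.
have := nice_lebesgue_differentiation nice_E locH lH.
have -> : H t = rnorm (f t - x).
  rewrite /H indicE mem_set/= ?in_itv/= ?at_ ?ltW// mulr1.
  by rewrite -gh//= in_itv/= at_ ltW.
apply: cvg_trans; apply: near_eq_cvg.
have : \forall n \near \oo, t + n.+1%:R^-1 < b.
  have := @cvg_harmonic R; move=> /cvgrPdist_lt/(_ (b - t)).
  rewrite subr_gt0 => /(_ tb); apply: filterS => n.
  by rewrite sub0r normrN gtr0_norm//= ltrBrDl.
apply: filterS => n tnb; rewrite -/(E t n) muE inver gt_eqF// invrK.
congr (_ * _)%E; apply: ge0_ae_eq_integral_nonmeasurable.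
- by move=> s _; rewrite lee_fin.
- by move=> s _; rewrite lee_fin rnorm_ge0.
apply: filterS gh' => s ghs; rewrite /E/= in_itv/= => /andP[ts stn].
have sab : s \in `[a, b] by rewrite in_itv/= (le_trans at_ ts) (le_trans stn)// ltW.
by rewrite ghs// /H indicE mem_set// mulr1.
Qed.

(* Lebesgue's theorem for the real functions |f - x|, where x runs through the
   countable dense set of values of an approximating sequence of simple
   functions. *)
Lemma bochner_lebesgue_differentiation f (a b : R) :
  bochner_integrable mu `[a, b] f ->
  {ae mu, forall t, a <= t < b -> forall e, 0 < e ->
    exists N, forall n, (N <= n)%N -> forall I,
      has_bochner_integral mu `[0, n.+1%:R^-1] (fun s => f (t + s)) I ->
      rnorm (n.+1%:R%:C%C *: I - f t) <= e}.
Proof.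
move=> fI; have mab := measurable_itv `[a, b].
have muab := lebesgue_measure_itvcc_lty a b.
have [s [ss sf]] := proj1 fI.
have /choice[r rE] : forall m, exists r : seq X, range (s m) = [set` r].
  move=> m; apply/finite_seqP.
  by have [] := (simple_funP (mu := mu) mab muab _).1 (ss m).
have : {ae mu, forall t, forall m k, a <= t < b ->
    (fun n => n.+1%:R%:E * \int[mu]_(u in `[t, (t + n.+1%:R^-1)%R])
       (rnorm (f u - nth 0 (r m) k))%:E)%E
    @ \oo --> (rnorm (f t - nth 0 (r m) k))%:E}.
  apply/ae_foralln => m; apply/ae_foralln => k.
  exact: rnorm_lebesgue_differentiation.
apply: filterS2 sf => t sf ft atb e e0.
have tab : `[a, b]%classic t by rewrite /= in_itv/=; move: atb; lra.
have e4 : 0 < e / 4 by rewrite divr_gt0.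
have /cvg_rnorm_seqP/(_ _ e4)[m sm] := sf tab.
have := sm m (leqnn m); set x := s m t => xf.
have xr : x \in r m.
  by have : range (s m) x by [exists t]; rewrite rE.
have := ft m (index x (r m)) atb; rewrite nth_index// => fx.
move/fine_cvgP : (fx) => [[N1 _ fN1] /cvgrPdist_lt/(_ _ e4)[N2 _ fN2]].
have [N3 _ tN3] : \forall n \near \oo, t + n.+1%:R^-1 < b.
  have /andP[_ tb] := atb.
  have := @cvg_harmonic R; move=> /cvgrPdist_lt/(_ (b - t)).
  rewrite subr_gt0 => /(_ tb); apply: filterS => n.
  by rewrite sub0r normrN gtr0_norm//= ltrBrDl.
exists (maxn N1 (maxn N2 N3)) => n; rewrite !geq_max => /and3P[n1 n2 n3] I It.
have n0 : 0 < n.+1%:R :> R by [].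
have mE := measurable_itv `[0, n.+1%:R^-1 : R].
have muE := lebesgue_measure_itvcc_lty 0 (n.+1%:R^-1 : R).
have mE' := measurable_itv `[t, t + n.+1%:R^-1].
have muE' := lebesgue_measure_itvcc_lty t (t + n.+1%:R^-1).
have sub : `[t, t + n.+1%:R^-1] `<=` `[a, b].
  have := tN3 n n3; move: atb => /andP[at_ tb] tnb u.
  rewrite /= !in_itv/= => /andP[tu ut].
  by rewrite (le_trans at_ tu) (le_trans ut)// ltW.
have Ix := has_bochner_integralB (mu := mu) mE muE It
  (has_bochner_integral_cst x mE muE).
move: Ix; rewrite lebesgue_measure_itvcc ?invr_ge0// subr0/= => Ix.
have := has_bochner_integral_rnorm (mu := mu) mE muE Ix.
have smx : strongly_measurable mu `[t, t + n.+1%:R^-1] (fun u => f u - x).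
  apply: (strongly_measurable_subset (mu := mu) mab sub mE' muab).
  apply: (strongly_measurableB (mu := mu) mab muab); first by case: fI.
  by case: (has_bochner_integral_cst x mab muab).
have := @L1_preimage _ _ _ _ mu _ (measurable_shift t)
  (@lebesgue_measure_shift R t) _ _ mE' muE' smx.
rewrite preimage_shift_itvcc subrr addrAC subrr add0r => -> IL.
have := fN1 n n1; have := fN2 n n2; rewrite /=.
set L := (_ * _)%E => Lx Lfin.
have IxL : rnorm (n.+1%:R%:C%C *: I - x) <= fine L.
  have -> : n.+1%:R%:C%C *: I - x = n.+1%:R%:C%C *: (I - (n.+1%:R^-1)%:C%C *: x).
    by rewrite scalerBr scalerA -rmorphM/= divff// scale1r.
  rewrite rnormZr ger0_norm// -lee_fin fineK// EFinM lee_wpmul2l//.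
rewrite -(subrKA x) (le_trans (rnorm_leD _ _))//.
have : fine L < rnorm (f t - x) + e / 4.
  by rewrite -ltrBlDl (le_lt_trans _ Lx)// distrC ler_norm.
by move: xf; rewrite (rnormB x); lra.
Qed.

End LocalIntegrals.

Section Intervals.
Context {R : realType}.
Variables (J : set R) (hJ : J = `[0, +oo[%classic \/ J = setT).
Local Notation mu := (@lebesgue_measure R).

Let J_half (t : R) : (`[0, +oo[%classic : set R) t = (0 <= t).
Proof. by rewrite /= in_itv/= andbT. Qed.

Lemma mem_upward t u : J t -> t <= u -> J u.
Proof. by case: hJ => ->//; rewrite !J_half; exact: le_trans. Qed.

Lemma mem_addr t x : J t -> 0 <= x -> J (t + x).
Proof. by move=> Jt x0; apply: mem_upward Jt _; rewrite lerDl. Qed.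

Lemma itvcc_sub a b : J a -> `[a, b] `<=` J.
Proof. by move=> Ja t /=; rewrite in_itv/= => /andP[at_ _]; exact: mem_upward at_. Qed.

Lemma mem_ge0 t : 0 <= t -> J t.
Proof. by case: hJ => ->//; rewrite J_half. Qed.

Definition retract (t : R) : R := if `[< J t >] then t else 0.

Lemma retract_id t : J t -> retract t = t.
Proof. by move=> /asboolT; rewrite /retract => ->. Qed.

Lemma mem_retract t : J (retract t).
Proof. by rewrite /retract; case: asboolP => // _; exact: mem_ge0. Qed.

Let notJ t : ~ J t -> t < 0.
Proof. by move=> Jt; rewrite ltNge; apply/negP => /mem_ge0. Qed.

Let J_neg t u : J t -> ~ J u -> 0 <= t.
Proof. by case: hJ => ->//; rewrite J_half. Qed.

Lemma retract_mono : {homo retract : t u / t <= u}.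
Proof.
move=> t u tu; rewrite /retract; case: asboolP => Jt; case: asboolP => Ju //.
  by case: Ju; exact: mem_upward tu.
exact: J_neg Jt.
Qed.

Lemma retract_lip t u : `|retract t - retract u| <= `|t - u|.
Proof.
rewrite /retract; case: asboolP => Jt; case: asboolP => Ju.
- by [].
- have := notJ Ju; have := J_neg Jt Ju => *; rewrite subr0 !ger0_norm; lra.
- have := notJ Jt; have := J_neg Ju Jt => *.
  by rewrite sub0r normrN ger0_norm// ler0_norm; lra.
- by rewrite subrr normr0.
Qed.

Lemma ae_not_itvcc t d (P : R -> Prop) : J t -> 0 < d ->
  {ae mu, forall s, J s -> P s} -> exists2 s, t <= s <= t + d & P s.
Proof.
move=> Jt d0 [N [mN N0 PN]]; apply: contrapT => nP.
have : (mu `[t, (t + d)%R] <= mu N)%E.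
  apply: le_measure; rewrite ?inE//= => s /=; rewrite in_itv/= => std.
  apply: PN => /= Ps; apply: nP; exists s => //; apply: Ps.
  by apply: mem_upward Jt _; case/andP: std.
have td : t <= t + d by rewrite lerDl ltW.
rewrite N0 lebesgue_measure_itvcc// addrAC subrr add0r lee_fin.
by rewrite leNgt d0.
Qed.

End Intervals.

Section LocallyUniformlyContinuous.
Context {R : realType} {X : completeNormedModType R[i]}.
Variables (J : set R) (hJ : J = `[0, +oo[%classic \/ J = setT).
Local Notation mu := (@lebesgue_measure R).
Implicit Types (f g : R -> X).

(* For functions on J this amounts to continuity. *)
Definition loc_unif_continuous f := forall a b e, J a -> 0 < e ->
  exists2 d, 0 < d & forall t x, a <= t <= b -> 0 <= x <= d ->
    rnorm (f (t + x) - f t) <= e.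
Local Notation luc := loc_unif_continuous.

Lemma luc_ext f g : (forall t, J t -> f t = g t) -> luc f -> luc g.
Proof.
move=> fg cf a b e Ja e0; have [d d0 fd] := cf a b e Ja e0.
exists d => // t x /andP[at_ tb] /andP[x0 xd].
have Jt : J t by exact: mem_upward at_.
rewrite -!fg//; last exact: mem_addr.
by apply: fd; apply/andP.
Qed.

Lemma continuous_luc f : continuous (f \o retract J) -> luc f.
Proof.
move=> cf; apply: (@luc_ext (f \o retract J)) => [t Jt /=|a b e Ja e0].
  by rewrite retract_id.
have [d d0 fd] := continuous_uniform_itvcc a b cf e0.
exists (d / 2) => [|t x atb /andP[x0 xd]]; first by rewrite divr_gt0.
apply/ltW/fd => //; rewrite addrAC subrr add0r ger0_norm//.
by rewrite (le_lt_trans xd)//; lra.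
Qed.

Lemma luc_continuous f : luc f -> continuous (f \o retract J).
Proof.
move=> cf; apply/continuous_rnormP => t e e0 /=.
have e20 : 0 < e / 2 by rewrite divr_gt0.
have [d d0 fd] := cf (retract J (t - 1)) (retract J (t + 1)) _
  (mem_retract hJ _) e20.
have wlog_le u v : `|u - t| < 1 -> `|v - t| < 1 -> u <= v -> v - u <= d ->
    rnorm (f (retract J v) - f (retract J u)) < e.
  rewrite !ltr_distl => /andP[? ?] /andP[? ?] uv vud.
  have {1}-> : retract J v = retract J u + (retract J v - retract J u).
    by rewrite addrC subrK.
  apply: (@le_lt_trans _ _ (e / 2)); last lra.
  apply: fd.
    by apply/andP; split; apply: (retract_mono hJ); lra.
  rewrite subr_ge0 (retract_mono hJ)//= (le_trans _ vud)//.
  rewrite (le_trans (ler_norm _))// (le_trans (retract_lip hJ _ _))//.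
  by rewrite ger0_norm ?subr_ge0.
exists (Num.min 1 d); first by rewrite lt_min ltr01.
move=> s; rewrite lt_min => /andP[s1 sd].
have tt : `|t - t| < 1 by rewrite subrr normr0.
have [ts|st] := leP t s.
  by apply: wlog_le => //; rewrite (le_trans (ler_norm _))// ltW.
rewrite rnormB; apply: wlog_le => //; first exact: ltW.
by rewrite (le_trans (ler_norm _))// distrC ltW.
Qed.

Lemma luc_everywhere f : continuous f -> luc f.
Proof.
move=> cf; apply: continuous_luc => t; apply: continuous_comp; last exact: cf.
apply/cvgrPdist_lt => e e0; exists e => //= s st.
exact: le_lt_trans (retract_lip hJ _ _) st.
Qed.

Lemma lucD f g : luc f -> luc g -> luc (fun t => f t + g t).
Proof.
move=> /luc_continuous cf /luc_continuous cg; apply: continuous_luc => t.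
by apply: continuousD; [exact: cf|exact: cg].
Qed.

Lemma luc_scale (c : R -> R[i]) f :
  (forall t e, 0 < e -> exists2 d, 0 < d &
    forall s, `|s - t| < d -> cmod (c s - c t) < e) ->
  luc f -> luc (fun t => c t *: f t).
Proof.
move=> cc /luc_continuous/continuous_rnormP cf; apply: continuous_luc.
apply/continuous_rnormP => t e e0 /=.
set r := retract J; set M := cmod (c (r t)); set N := rnorm (f (r t)).
have M0 : 0 <= M by exact: cmod_ge0.
have N0 : 0 <= N by exact: rnorm_ge0.
have [d1 d10 fd1] := cf t (e / 2 / (M + 1)) ltac:(by rewrite !divr_gt0// ltr_wpDl).
have [d2 d20 cd2] := cc (r t) (e / 2 / (N + 1)) ltac:(by rewrite !divr_gt0// ltr_wpDl).
have [d3 d30 cd3] := cc (r t) 1 ltr01.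
exists (Num.min d1 (Num.min d2 d3)); first by rewrite !lt_min d10 d20.
move=> s; rewrite !lt_min => /and3P[/fd1/= fs sd2 sd3].
have /cd2 cs2 := le_lt_trans (retract_lip hJ s t) sd2.
have /cd3 cs3 := le_lt_trans (retract_lip hJ s t) sd3.
have -> : c (r s) *: f (r s) - c (r t) *: f (r t) =
    c (r s) *: (f (r s) - f (r t)) + (c (r s) - c (r t)) *: f (r t).
  by rewrite scalerBr scalerBl addrA subrK.
apply: (le_lt_trans (rnorm_leD _ _)); rewrite !rnormZ -/N (splitr e).
have cM : cmod (c (r s)) <= M + 1.
  by rewrite -lerBlDl (le_trans (cmod_dist _ _))// ltW.
apply: ltr_leD.
  apply: (@le_lt_trans _ _ ((M + 1) * rnorm (f (r s) - f (r t)))).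
    by rewrite ler_wpM2r ?rnorm_ge0.
  by rewrite mulrC -ltr_pdivlMr// ltr_wpDl.
apply: (@le_trans _ _ (e / 2 / (N + 1) * N)).
  by rewrite ler_wpM2r// ltW.
rewrite mulrAC ler_pdivrMr ?ltr_wpDl// ler_wpM2l ?lerDl//.
by rewrite ltW// divr_gt0.
Qed.

Lemma lucZ (c : R[i]) f : luc f -> luc (fun t => c *: f t).
Proof.
apply: luc_scale => t e e0; exists 1 => // s _.
by rewrite subrr /cmod normr0.
Qed.

Lemma lucB f g : luc f -> luc g -> luc (fun t => f t - g t).
Proof.
move=> cf /(lucZ (-1)) cg; have := lucD cf cg.
by apply: luc_ext => t _; rewrite scaleN1r.
Qed.

Lemma luc_comp f (y : R -> R) : (forall t, J t -> J (y t)) -> continuous y ->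
  luc f -> luc (f \o y).
Proof.
move=> Jy cy /luc_continuous cf; apply: continuous_luc.
have -> : (f \o y) \o retract J = (f \o retract J) \o (y \o retract J).
  apply/funext => t /=; rewrite [retract J (y _)]retract_id//.
  exact: Jy _ (mem_retract hJ t).
move=> t; apply: continuous_comp; last exact: cf.
apply: continuous_comp; last exact: cy.
apply/cvgrPdist_lt => e e0; exists e => //= s st.
exact: le_lt_trans (retract_lip hJ _ _) st.
Qed.

Lemma luc_shift f s : 0 <= s -> luc f -> luc (fun t => f (t + s)).
Proof.
move=> s0; apply: (@luc_comp f (fun t => t + s)) => [t Jt|t].
  exact: mem_addr.
by apply: cvgD; [exact: cvg_id|exact: cvg_cst].
Qed.

Lemma luc_at f t e : luc f -> J t -> 0 < e ->
  exists2 d, 0 < d & forall x, 0 <= x <= d -> rnorm (f (t + x) - f t) <= e.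
Proof.
move=> cf Jt e0; have [d d0 fd] := cf t t e Jt e0.
by exists d => // x; apply: fd; rewrite !le_refl.
Qed.

Lemma luc_ae_eq f g t : luc f -> luc g -> f = g %[ae mu in J] -> J t ->
  f t = g t.
Proof.
move=> cf cg fg Jt; apply/eqP; rewrite -subr_eq0; apply/eqP.
apply: rnorm_small => e e0.
have [d d0 fd] := luc_at (lucB cf cg) Jt e0.
have [s /andP[ts std] fgs] := ae_not_itvcc hJ Jt d0 fg.
have := fd (s - t); rewrite (addrC t) subrK fgs subrr sub0r rnormN; apply.
by rewrite subr_ge0 ts lerBlDl.
Qed.

Lemma compact_sub_measure (K : set R) : compact K ->
  measurable K /\ (mu K < +oo)%E.
Proof.
move=> cK; split; first exact: compact_measurable.
exact: compact_finite_measure.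
Qed.

Lemma luc_L1loc f : luc f -> L1loc J f.
Proof.
move=> /luc_continuous cf K cK KJ.
have [mK muK] := compact_sub_measure cK.
apply/(bochner_integrableP (mu := mu) mK muK).
have /(bochner_integrableP (mu := mu) mK muK)[I fI] :=
  continuous_bochner_integrable cf cK.
exists I; apply: has_bochner_integral_ae fI.
by apply: aeW => t /KJ Jt /=; rewrite retract_id.
Qed.

Lemma L1loc_ae f g : f = g %[ae mu in J] -> L1loc J f -> L1loc J g.
Proof.
move=> fg fJ K cK KJ; have [mK muK] := compact_sub_measure cK.
apply/(bochner_integrableP (mu := mu) mK muK).
have /(bochner_integrableP (mu := mu) mK muK)[I fI] := fJ K cK KJ.
exists I; apply: (has_bochner_integral_ae (mu := mu) _ fI).
have [N [mN N0 fgN]] := fg; exists N; split=> // t /= Kt.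
by apply: fgN => /= ft; apply: Kt => /KJ.
Qed.

End LocallyUniformlyContinuous.

(** * Means *)

Section HasMean.
Context {R : realType} {X : completeNormedModType R[i]}.
Local Notation mu := (@lebesgue_measure R).
Implicit Types (phi psi : R -> X) (m : X) (h k C : R).
Local Open Scope complex_scope.

Definition has_mean h phi m :=
  has_bochner_integral mu `[0, h] phi (h%:C *: m).

Let mI h : measurable `[0, h]%classic.
Proof. exact: measurable_itv. Qed.

Let muI h : (mu `[0%R, h] < +oo)%E.
Proof. exact: lebesgue_measure_itvcc_lty. Qed.

Let hC h : 0 < h -> h%:C != 0.
Proof. by move=> h0; rewrite eq_complex/= eqxx andbT gt_eqF. Qed.

Lemma has_mean_unique h phi m m' : 0 < h ->
  has_mean h phi m -> has_mean h phi m' -> m = m'.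
Proof.
move=> h0 mm mm'; apply: (@scalerI _ _ h%:C); first exact: hC.
exact: (has_bochner_integral_unique (mu := mu) (@mI h) (@muI h) mm mm').
Qed.

Lemma has_mean_ext h phi psi m : (forall s, 0 <= s <= h -> phi s = psi s) ->
  has_mean h phi m -> has_mean h psi m.
Proof.
move=> pp; apply: has_bochner_integral_ae; apply: aeW => s.
by rewrite /= in_itv/=; exact: pp.
Qed.

Lemma has_meanD h phi psi m m' : has_mean h phi m -> has_mean h psi m' ->
  has_mean h (fun s => phi s + psi s) (m + m').
Proof.
by rewrite /has_mean scalerDr; exact: (has_bochner_integralD (mu := mu) (@mI h) (@muI h)).
Qed.

Lemma has_meanZ (c : R[i]) h phi m : has_mean h phi m ->
  has_mean h (fun s => c *: phi s) (c *: m).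
Proof.
rewrite /has_mean scalerA mulrC -scalerA.
exact: (has_bochner_integralZ (mu := mu) (@mI h) (@muI h)).
Qed.

Lemma has_meanB h phi psi m m' : has_mean h phi m -> has_mean h psi m' ->
  has_mean h (fun s => phi s - psi s) (m - m').
Proof.
by rewrite /has_mean scalerBr; exact: (has_bochner_integralB (mu := mu) (@mI h) (@muI h)).
Qed.

Lemma has_mean_cst h m : 0 <= h -> has_mean h (fun=> m) m.
Proof.
move=> h0; have := has_bochner_integral_cst m (@mI h) (@muI h).
by rewrite lebesgue_measure_itvcc// subr0.
Qed.

Lemma has_mean_le h phi m C : 0 < h -> has_mean h phi m ->
  (forall s, 0 <= s <= h -> rnorm (phi s) <= C) -> rnorm m <= C.
Proof.
move=> h0 hm pC.
have C0 : 0 <= C by apply: le_trans (rnorm_ge0 _) (pC 0 _); rewrite le_refl ltW.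
have := has_bochner_integral_bound (mI h) (@muI h) C0 hm.
rewrite rnormZr gtr0_norm// lebesgue_measure_itvcc ?(ltW h0)// subr0/= mulrC.
by rewrite ler_pM2r//; apply => s; rewrite /= in_itv/=; exact: pC.
Qed.

Lemma has_mean_itvD h k phi m m' : 0 <= h -> 0 <= k ->
  has_mean h phi m -> has_mean k (fun s => phi (h + s)) m' ->
  has_bochner_integral mu `[0, h + k] phi (h%:C *: m + k%:C *: m').
Proof. exact: has_bochner_integral_itvD. Qed.

End HasMean.

Section Mean.
Context {R : realType} {X : completeNormedModType R[i]}.
Variables (J : set R) (hJ : J = `[0, +oo[%classic \/ J = setT).
Local Notation mu := (@lebesgue_measure R).
Implicit Types (f g : R -> X).
Local Notation luc := (loc_unif_continuous J).
Local Open Scope complex_scope.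

Lemma L1loc_itv f a b : L1loc J f -> J a -> bochner_integrable mu `[a, b] f.
Proof.
by move=> fJ Ja; apply: fJ; [exact: segment_compact|exact: itvcc_sub].
Qed.

Lemma has_bochner_integral_L1loc f t h : L1loc J f -> J t ->
  has_bochner_integral mu `[0, h] (fun s => f (t + s))
    (bochner_integral mu `[0, h] (fun s => f (t + s))).
Proof.
move=> fJ Jt.
have mt := measurable_itv `[t, t + h].
have mut := lebesgue_measure_itvcc_lty t (t + h).
have /(bochner_integrableP (mu := mu) mt mut)[I fI] := L1loc_itv (t + h) fJ Jt.
have := has_bochner_integral_shift t mt mut fI.
rewrite preimage_shift_itvcc subrr addrAC subrr add0r => hI.
have m0 := measurable_itv `[0, h].
have mu0 := lebesgue_measure_itvcc_lty 0 h.
by rewrite (bochner_integralE (mu := mu) m0 mu0 hI).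
Qed.

Lemma has_mean_mean f t h : L1loc J f -> J t -> 0 < h ->
  has_mean h (fun s => f (t + s)) (mean h f t).
Proof.
move=> fJ Jt h0; rewrite /has_mean /mean scalerA -rmorphM/= divff ?gt_eqF//.
by rewrite scale1r; exact: has_bochner_integral_L1loc.
Qed.

Lemma meanE f t h m : L1loc J f -> J t -> 0 < h ->
  has_mean h (fun s => f (t + s)) m -> mean h f t = m.
Proof. by move=> fJ Jt h0; apply: has_mean_unique => //; exact: has_mean_mean. Qed.

Lemma mean_ae f g t h : f = g %[ae mu in J] -> L1loc J f -> J t -> 0 < h ->
  mean h f t = mean h g t.
Proof.
move=> fg fJ Jt h0.
have gJ := L1loc_ae fg fJ.
apply: (meanE fJ Jt h0).
apply: (has_bochner_integral_ae (mu := mu) _ (has_mean_mean gJ Jt h0)).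
have [N [mN N0 fgN]] := ae_shift t fg; exists N; split=> // s /= Hs.
apply: fgN => /= fgs; apply: Hs; rewrite in_itv/= => /andP[s0 _].
by rewrite fgs//; exact: mem_addr.
Qed.

Lemma has_bochner_integral_L1locD f t h k I : L1loc J f -> J t -> 0 <= h -> 0 <= k ->
  has_bochner_integral mu `[0, h + k] (fun s => f (t + s)) I ->
  I = bochner_integral mu `[0, h] (fun s => f (t + s)) +
      bochner_integral mu `[0, k] (fun s => f (t + h + s)).
Proof.
move=> fJ Jt h0 k0 hI.
have m0 := measurable_itv `[0, h + k].
have mu0 := lebesgue_measure_itvcc_lty 0 (h + k).
apply: (has_bochner_integral_unique (mu := mu) m0 mu0 hI).
apply: has_bochner_integral_itvD => //.
  exact: has_bochner_integral_L1loc.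
have := has_bochner_integral_L1loc k fJ (mem_addr hJ Jt h0).
by congr has_bochner_integral; apply/funext => s; rewrite addrA.
Qed.

Local Notation It f t h := (bochner_integral mu `[0, h] (fun s => f (t + s))).

Lemma bochner_integral_itvD f t h k : L1loc J f -> J t -> 0 <= h -> 0 <= k ->
  It f t (h + k) = It f t h + It f (t + h) k.
Proof.
move=> fJ Jt h0 k0.
exact: has_bochner_integral_L1locD (has_bochner_integral_L1loc _ fJ Jt).
Qed.

Lemma primitive_small f a b e : L1loc J f -> J a -> 0 < e ->
  exists2 d, 0 < d & forall t x, a <= t -> 0 <= x <= d -> t + x <= b ->
    rnorm (It f t x) <= e.
Proof.
move=> fJ Ja e0.
have [d d0 fd] := bochner_integral_itv_small (L1loc_itv b fJ Ja) e0.
exists d => // t x at_ xd txb; apply: (fd t x) => //.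
exact: has_bochner_integral_L1loc fJ (mem_upward hJ Ja at_).
Qed.

Lemma primitive_luc f t : L1loc J f -> J t ->
  loc_unif_continuous `[0, +oo[%classic (fun h => It f t h).
Proof.
move=> fJ Jt a b e; rewrite /= in_itv/= andbT => a0 e0.
have [d d0 fd] := primitive_small (t + b + 1) fJ (mem_addr hJ Jt a0) e0.
exists (Num.min d 1); first by rewrite lt_min d0 ltr01.
move=> x y /andP[ax xb] /andP[y0]; rewrite le_min => /andP[yd y1].
rewrite (bochner_integral_itvD fJ Jt (le_trans a0 ax) y0) addrAC subrr add0r.
by apply: fd; rewrite ?lerD2l ?y0//; lra.
Qed.

Lemma mean_increment_primitive f t x h : L1loc J f -> J t -> 0 <= x -> 0 < h ->
  mean h f (t + x) - mean h f t =
  (h^-1)%:C *: (It f (t + h) x - It f t x).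
Proof.
move=> fJ Jt x0 h0.
have -> : mean h f (t + x) - mean h f t =
    (h^-1)%:C *: (It f (t + x) h - It f t h) by rewrite scalerBr.
congr (_ *: _).
have E : It f t h + It f (t + h) x = It f t x + It f (t + x) h.
  have h0' := ltW h0.
  rewrite -(bochner_integral_itvD fJ Jt h0' x0) (addrC h).
  by rewrite (bochner_integral_itvD fJ Jt x0 h0').
move: E; move: (It _ _ _) (It _ _ _) (It _ _ _) (It _ _ _) => A B C D E.
by rewrite -[C](addKr D) E; zmodule.
Qed.

Lemma mean_le f t h C : L1loc J f -> J t -> 0 < h ->
  (forall s, 0 <= s <= h -> rnorm (f (t + s)) <= C) -> rnorm (mean h f t) <= C.
Proof. by move=> fJ Jt h0; exact: has_mean_le (has_mean_mean fJ Jt h0). Qed.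

Lemma mean_increment_swap f t x h : L1loc J f -> J t -> 0 < x -> 0 < h ->
  mean h f (t + x) - mean h f t =
  (x / h)%:C *: (mean x f (t + h) - mean x f t).
Proof.
move=> fJ Jt x0 h0; rewrite (mean_increment_primitive fJ Jt (ltW x0) h0).
have -> : mean x f (t + h) - mean x f t =
    (x^-1)%:C *: (It f (t + h) x - It f t x) by rewrite scalerBr.
move: (It _ _ _ - _) => A.
by rewrite scalerA -rmorphM/= mulrAC divff ?gt_eqF// mul1r.
Qed.

Lemma mean_luc f h : L1loc J f -> 0 < h -> luc (mean h f).
Proof.
move=> fJ h0 a b e Ja e0.
have e20 : 0 < e * h / 2 by rewrite divr_gt0// mulr_gt0.
have [d d0 fd] := primitive_small (b + h + 1) fJ Ja e20.
exists (Num.min d 1); first by rewrite lt_min d0 ltr01.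
move=> t x /andP[at_ tb] /andP[x0]; rewrite le_min => /andP[xd x1].
rewrite (mean_increment_primitive fJ (mem_upward hJ Ja at_))// rnormZr gtr0_norm ?invr_gt0//.
rewrite mulrC ler_pdivrMr// (le_trans (rnorm_leB _ _))//.
rewrite (splitr (e * h)); apply: lerD.
  by apply: fd; rewrite ?x0//; lra.
by apply: fd; rewrite ?x0//; lra.
Qed.

End Mean.

Section MeanCommute.
Context {R : realType} {X : completeNormedModType R[i]}.
Variables (J : set R) (hJ : J = `[0, +oo[%classic \/ J = setT).
Local Notation mu := (@lebesgue_measure R).
Implicit Types (f g : R -> X).
Local Open Scope complex_scope.
Local Notation It f t h := (bochner_integral mu `[0, h] (fun s => f (t + s))).

(* Both sides are second differences of a twofold primitive of f. *)
Lemma mean_commute f h k t : L1loc J f -> J t -> 0 < h -> 0 < k ->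
  mean h (mean k f) t = mean k (mean h f) t.
Proof.
move=> fJ Jt h0 k0.
pose H : set R := `[0, +oo[%classic.
have hH : H = `[0, +oo[%classic \/ H = setT by left.
pose P h := It f t h.
have PH : L1loc H P by exact/(luc_L1loc hH)/(primitive_luc hJ).
have H0 x : 0 <= x -> H x by rewrite /H /= in_itv/= andbT.
suff E a b : 0 < a -> 0 < b -> mean a (mean b f) t =
    (a^-1)%:C *: ((b^-1)%:C *: (It P 0 (a + b) - It P 0 b - It P 0 a)).
  rewrite (E h k h0 k0) (E k h k0 h0) (addrC h k).
  move: (It P 0 (k + h)) (It P 0 h) (It P 0 k) => x y z.
  by rewrite scalerA mulrC -scalerA addrAC.
move=> a0 b0; apply: (meanE hJ) => //.
  by apply: (luc_L1loc hJ); exact: mean_luc.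
rewrite /has_mean scalerA -rmorphM/= divff ?gt_eqF// scale1r.
have -> : It P 0 (a + b) - It P 0 b = It P b a.
  rewrite (addrC a) (bochner_integral_itvD hH PH (H0 0 (lexx _)) (ltW b0) (ltW a0)).
  by rewrite add0r addrAC subrr add0r.
have ma := measurable_itv `[0, a].
have mua := lebesgue_measure_itvcc_lty 0 a.
have := has_bochner_integralZ (mu := mu) ma mua (b^-1)%:C
  (has_bochner_integralB (mu := mu) ma mua
    (has_bochner_integral_L1loc hH a PH (H0 b (ltW b0)))
    (has_bochner_integral_L1loc hH a PH (H0 0 (lexx _)))).
apply: has_bochner_integral_ae; apply: aeW => s /=; rewrite in_itv/= => /andP[s0 sa].
rewrite /mean; congr (_ *: _).
rewrite /P add0r (addrC b) (bochner_integral_itvD hJ fJ Jt s0 (ltW b0)).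
by rewrite addrAC subrr add0r.
Qed.

Lemma mean_lebesgue_differentiation f : L1loc J f ->
  {ae mu, forall t, J t -> forall e, 0 < e ->
    exists N, forall n, (N <= n)%N -> rnorm (mean n.+1%:R^-1 f t - f t) <= e}.
Proof.
move=> fJ.
have : {ae mu, forall t, forall m : nat, retract J (- m%:R) <= t < m%:R ->
    forall e : R, 0 < e -> exists N, forall n, (N <= n)%N -> forall I,
      has_bochner_integral mu `[0, n.+1%:R^-1] (fun s => f (t + s)) I ->
      rnorm (n.+1%:R%:C *: I - f t) <= e}.
  apply/ae_foralln => m; apply: bochner_lebesgue_differentiation.
  exact: (L1loc_itv hJ _ fJ (mem_retract hJ _)).
apply: ae_imply => t ft Jt e e0.
pose m := Num.bound `|t|.
have tm : `|t| < m%:R by rewrite archi_boundP//.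
have [|N fN] := ft m _ e e0.
  move: tm; rewrite ltr_norml => /andP[tm ->]; rewrite andbT.
  by rewrite -[leRHS](retract_id Jt) retract_mono// ltW.
exists N => n Nn; rewrite /mean invrK; apply: fN => //.
exact: (has_bochner_integral_L1loc hJ).
Qed.

End MeanCommute.

(** * Continuity from continuous differences *)

Local Opaque mean.

Section BaireInterval.
Context {R : realType}.
Implicit Types (s c d : R).

Lemma baire_interval (P : nat -> R -> Prop) :
  (forall n s, 1 <= s <= 2 ->
    (forall d, 0 < d -> exists s', [/\ 1 <= s' <= 2, `|s' - s| < d & P n s']) ->
    P n s) ->
  (forall s, 1 <= s <= 2 -> exists n, P n s) ->
  exists n s c, [/\ 1 <= s, 0 < c & forall x, 0 <= x <= c -> P n (s + x)].
Proof.
move=> clP covP; apply: contrapT => noint.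
pose F n : set R^o := ~` [set s | 1 <= s <= 2 /\ P n s].
have clE n : @closed R^o [set s | 1 <= s <= 2 /\ P n s].
  move=> s sE.
  have s12 : 1 <= s <= 2.
    have : closed (`[1, 2]%classic : set R) by exact: itv_closed.
    move=> /(_ s); rewrite /= in_itv/=; apply=> B /sE[s' [[s'12 _] Bs']].
    by exists s'; split=> //=; rewrite in_itv.
  split=> //; apply: clP => // d d0.
  have [s' [[s'12 Ps'] ss']] := sE (ball s d) (nbhsx_ballx s d d0).
  by exists s'; split=> //; rewrite distrC.
have /Baire densF : forall n, open (F n) /\ dense (F n).
  move=> n; split; first exact: closed_openC.
  move=> D [x Dx] oD; apply: contrapT => DF; apply: noint.
  have DE : D `<=` [set s | 1 <= s <= 2 /\ P n s].
    move=> y Dy; apply: contrapT => nPy; apply: DF; exists y.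
    by split.
  have /nbhs_ballP[r /= r0 rD] : nbhs x D by exact: open_nbhs_nbhs.
  exists n, x, (r / 2); split; first by have [/andP[]] := DE _ Dx.
    by rewrite divr_gt0.
  move=> y /andP[y0 yr].
  have : D (x + y).
    apply: rD; rewrite /ball/= opprD addrA subrr sub0r normrN ger0_norm//.
    by lra.
  by move/DE => [].
have [|x [x12 xF]] := densF `]1, 2[%classic _
  (@interval_open R (BRight 1) (BLeft 2) isT isT).
  by exists (3 / 2); rewrite /= in_itv/=; lra.
have x12' : 1 <= x <= 2 by move: x12; rewrite /= in_itv/=; lra.
have [n Pn] := covP _ x12'.
exact: (xF n I).
Qed.

End BaireInterval.

Section Increments.
Context {R : realType} {X : completeNormedModType R[i]}.
Variables (J : set R) (hJ : J = `[0, +oo[%classic \/ J = setT).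
Local Notation mu := (@lebesgue_measure R).
Implicit Types (f g : R -> X).
Local Notation luc := (loc_unif_continuous J).
Local Open Scope complex_scope.

Lemma rnorm_cvg_le (u : nat -> X) (l : X) (C : R) : u @ \oo --> l ->
  (\forall n \near \oo, rnorm (u n) <= C) -> rnorm l <= C.
Proof.
move=> /cvg_rnorm_seqP ul [N _ uC]; apply/ler_addgt0Pr => e e0.
have [M uM] := ul e e0.
have := uC (maxn N M) (leq_maxl _ _); have := uM (maxn N M) (leq_maxr _ _).
set v := u _ => lv vC; rewrite -(subrK v l) addrC.
by rewrite (le_trans (rnorm_leD _ _))// lerD// ltW.
Qed.

Lemma luc_near f t e : luc f -> J t -> 0 < e ->
  exists2 d, 0 < d & forall s, J s -> `|s - t| < d -> rnorm (f s - f t) <= e.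
Proof.
move=> /(luc_continuous hJ)/continuous_rnormP cf Jt e0.
have [d d0 fd] := cf t e e0; exists d => // s Js st.
by have := fd s st; rewrite /= !retract_id// => /ltW.
Qed.

Lemma mean_increment g t x h C : L1loc J g -> J t -> 0 <= x -> 0 < h ->
  (forall y, 0 <= y <= h -> rnorm (g (t + y + x) - g (t + y)) <= C) ->
  rnorm (mean h g (t + x) - mean h g t) <= C.
Proof.
move=> gJ Jt x0 h0 gC.
apply: (has_mean_le h0 (has_meanB (has_mean_mean hJ gJ (mem_addr hJ Jt x0) h0)
  (has_mean_mean hJ gJ Jt h0))).
by move=> y yh; rewrite (addrAC t); exact: gC.
Qed.

Lemma mean_difference f d s t h : L1loc J f -> luc d ->
  difference s f = d %[ae mu in J] -> 0 <= s -> J t -> 0 < h ->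
  mean h f (t + s) - mean h f t = mean h d t.
Proof.
move=> fJ dJ fd s0 Jt h0.
have m1 := has_meanB (has_mean_mean hJ fJ (mem_addr hJ Jt s0) h0)
  (has_mean_mean hJ fJ Jt h0).
apply/esym; apply: (meanE hJ (luc_L1loc hJ dJ) Jt h0).
apply: (has_bochner_integral_ae (mu := mu) _ m1).
apply: ae_imply (ae_shift t fd) => y dy; rewrite /= in_itv/= => /andP[y0 _].
by rewrite -dy; [rewrite /difference addrAC|exact: mem_addr].
Qed.

Lemma mean_dist f t h C : L1loc J f -> J t -> 0 < h ->
  (forall y, 0 <= y <= h -> rnorm (f (t + y) - f t) <= C) ->
  rnorm (mean h f t - f t) <= C.
Proof.
move=> fJ Jt h0 fC.
exact: (has_mean_le h0 (has_meanB (has_mean_mean hJ fJ Jt h0)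
  (has_mean_cst (f t) (ltW h0)))).
Qed.

Variable f : R -> X.
Hypotheses (fJ : L1loc J f)
  (df : forall s, 0 < s -> exists2 d, luc d & difference s f = d %[ae mu in J]).

Lemma mean_equicontinuous a b e : J a -> 0 < e ->
  exists2 d, 0 < d & forall h x t, 0 < h <= d -> 0 <= x <= d -> a <= t <= b ->
    rnorm (mean h f (t + x) - mean h f t) <= e.
Proof.
move=> Ja e0; have e20 : 0 < e / 2 by rewrite divr_gt0.
pose D s h x t := (mean h f (t + x + s) - mean h f (t + x)) -
  (mean h f (t + s) - mean h f t).
pose P n s := forall h x t, 0 < h <= n.+1%:R^-1 -> 0 <= x <= n.+1%:R^-1 ->
  a <= t <= b -> rnorm (D s h x t) <= e / 2.
have mluc h : 0 < h -> luc (mean h f) by move=> h0; exact: mean_luc.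
have [n s s12 Ps|s s12|n [s [c [s1 c0 Pn]]]] := @baire_interval R P.
- move=> h x t /andP[h0 hn] /andP[x0 xn] /andP[at_ tb].
  have Jt := mem_upward hJ Ja at_; have Jtx := mem_addr hJ Jt x0.
  have s0 : 0 <= s by lra.
  apply/ler_addgt0Pr => r r0; have r20 : 0 < r / 2 by rewrite divr_gt0.
  have [d1 d10 fd1] := luc_near (mluc h h0) (mem_addr hJ Jtx s0) r20.
  have [d2 d20 fd2] := luc_near (mluc h h0) (mem_addr hJ Jt s0) r20.
  have [|s' [s'12]] := Ps (Num.min d1 d2); first by rewrite lt_min d10.
  rewrite lt_min => /andP[sd1 sd2] Ps'.
  have := Ps' h x t; rewrite h0 hn x0 xn at_ tb => /(_ isT isT isT).
  have s'0 : 0 <= s' by lra.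
  have d1s' : rnorm (mean h f (t + x + s') - mean h f (t + x + s)) <= r / 2.
    by apply: fd1; [exact: mem_addr|rewrite [t + x + _]addrC addrKA].
  have d2s' : rnorm (mean h f (t + s') - mean h f (t + s)) <= r / 2.
    by apply: fd2; [exact: mem_addr|rewrite [t + _]addrC addrKA].
  move=> Ds'; have -> : D s h x t = D s' h x t -
      ((mean h f (t + x + s') - mean h f (t + x + s)) -
       (mean h f (t + s') - mean h f (t + s))).
    by rewrite /D; do ![move: (mean _ _ _) => ?]; zmodule.
  apply: (le_trans (rnorm_leB _ _)); apply: lerD; first exact: Ds'.
  rewrite (splitr r); apply: (le_trans (rnorm_leB _ _)).
  exact: (lerD d1s' d2s').
- have s0 : 0 < s by lra.
  have [d dl fd] := df s0.
  have [r r0 dr] := dl a (b + 1) _ Ja e20.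
  have [|n] := exists_invS_le (e := Num.min r 1); first by rewrite lt_min r0 ltr01.
  rewrite le_min => /andP[nr n1].
  exists n => h x t /andP[h0 hn] /andP[x0 xn] /andP[at_ tb].
  have Jt := mem_upward hJ Ja at_.
  rewrite /D (mean_difference fJ dl fd (ltW s0) (mem_addr hJ Jt x0) h0).
  rewrite (mean_difference fJ dl fd (ltW s0) Jt h0).
  apply: mean_increment => //; first exact: luc_L1loc.
  move=> y /andP[y0 yh]; apply: dr; rewrite ?x0 ?(le_trans xn)//=.
  by rewrite (le_trans at_) ?lerDl//= lerD// (le_trans yh)// (le_trans hn).
have [d1 d10 fd1] := mean_luc hJ fJ c0 (b + s + 1)
  (mem_addr hJ Ja (le_trans ler01 s1)) e20.
exists (Num.min n.+1%:R^-1 (Num.min d1 1)).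
  by rewrite !lt_min d10 invr_gt0 ltr0Sn ltr01.
move=> h x t; rewrite !le_min => /andP[h0 /and3P[hn hd1 h1]].
move=> /andP[x0 /and3P[xn xd1 x1]] /andP[at_ tb].
have s0 : 0 <= s by lra.
have Jt := mem_upward hJ Ja at_; have Jtx := mem_addr hJ Jt x0.
have Jts := mem_addr hJ Jt s0; have Jtxs := mem_addr hJ Jtx s0.
have lm := luc_L1loc hJ (mluc h h0).
have hm := has_meanB (has_meanB (has_mean_mean hJ lm Jtxs c0)
   (has_mean_cst (mean h f (t + x)) (ltW c0)))
  (has_meanB (has_mean_mean hJ lm Jts c0) (has_mean_cst (mean h f t) (ltW c0))).
have := has_mean_le c0 hm (C := e / 2).
rewrite !(mean_commute hJ fJ _ c0 h0)//.
set A := mean h (mean c f) (t + x + s); set B := mean h (mean c f) (t + s).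
set u := mean h f (t + x); set v := mean h f t.
have AB : rnorm (A - B) <= e / 2.
  have Axs : t + x + s = t + s + x by rewrite addrAC.
  rewrite /A /B Axs.
  apply: (mean_increment (luc_L1loc hJ (mean_luc hJ fJ c0)) Jts x0 h0).
  by move=> y /andP[y0 yh]; apply: fd1; apply/andP; split; lra.
move=> H; have {}H : rnorm ((A - u) - (B - v)) <= e / 2.
  apply: H => y /andP[y0 yc].
  have := Pn y; rewrite y0 yc => /(_ isT h x t); rewrite h0 hn x0 xn at_ tb.
  by rewrite /D !addrA; apply.
have -> : u - v = (A - B) - ((A - u) - (B - v)).
  by move: A B u v {AB H} => A B u v; zmodule.
by rewrite (le_trans (rnorm_leB _ _))// (splitr e) lerD.
Qed.

Lemma mean_cauchy a b e : J a -> 0 < e ->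
  exists2 d, 0 < d & forall h k t, 0 < h <= d -> 0 < k <= d -> a <= t <= b ->
    rnorm (mean h f t - mean k f t) <= e.
Proof.
move=> Ja e0; have e20 : 0 < e / 2 by rewrite divr_gt0.
have [d d0 fd] := mean_equicontinuous b Ja e20; exists d => // h k t.
move=> /[dup] hd /andP[h0 hd'] /[dup] kd /andP[k0 kd'] /[dup] atb /andP[at_ tb].
have Jt := mem_upward hJ Ja at_.
have close p q : 0 < p <= d -> 0 < q <= d ->
    rnorm (mean q (mean p f) t - mean p f t) <= e / 2.
  move=> pd /andP[q0 qd]; have p0 : 0 < p by case/andP: pd.
  apply: mean_dist => //; first exact/(luc_L1loc hJ)/mean_luc.
  by move=> y /andP[y0 yq]; apply: fd; rewrite // y0 (le_trans yq).
have := close h k hd kd; have := close k h kd hd.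
rewrite (mean_commute hJ fJ Jt k0 h0).
move: (mean h (mean k f) t) (mean h f t) (mean k f t) => A B C AC AB.
have -> : B - C = (A - C) - (A - B) by zmodule.
by rewrite (le_trans (rnorm_leB _ _))// (splitr e) lerD.
Qed.

Lemma L1loc_ae_luc : exists2 g, luc g & f = g %[ae mu in J].
Proof.
have invS_small (d : R) : 0 < d -> exists N, forall n, (N <= n)%N ->
    0 < (n.+1%:R^-1 : R) <= d.
  move=> /exists_invS_le[N Nd]; exists N => n Nn; rewrite invr_gt0 ltr0Sn/=.
  by rewrite (le_trans _ Nd)// lef_pV2 ?posrE// ler_nat ltnS.
have /choice[g gP] : forall t, exists l : X, J t ->
    (fun n => mean n.+1%:R^-1 f t) @ \oo --> l.
  move=> t; have [Jt|Jt] := pselect (J t); last by exists 0.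
  suff [l fl] : exists l : X, (fun n => mean n.+1%:R^-1 f t) @ \oo --> l.
    by exists l.
  apply: rnorm_complete => e e0; have e20 : 0 < e / 2 by rewrite divr_gt0.
  have [d d0 fd] := mean_cauchy t Jt e20.
  have [N Nd] := invS_small d d0; exists N => m n Nm Nn.
  rewrite (@le_lt_trans _ _ (e / 2))//; last by lra.
  by apply: fd; rewrite ?Nd// !le_refl.
exists g.
  move=> a b e Ja e0; have [d d0 fd] := mean_equicontinuous b Ja e0.
  exists d => // t x atb xd; have Jt : J t.
    by apply: mem_upward Ja _ => //; case/andP: atb.
  have x0 : 0 <= x by case/andP: xd.
  have lim := cvgB (gP _ (mem_addr hJ Jt x0)) (gP _ Jt).
  apply: (rnorm_cvg_le (lim _)); have [N Nd] := invS_small d d0.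
  by exists N => // n /= Nn; apply: fd; rewrite ?Nd.
apply: ae_imply (mean_lebesgue_differentiation hJ fJ) => t ft Jt.
apply/eqP; rewrite -subr_eq0; apply/eqP/rnorm_small => e e0.
have e20 : 0 < e / 2 by rewrite divr_gt0.
have [N fN] := ft Jt _ e20.
have /cvg_rnorm_seqP/(_ _ e20)[M gM] := gP t Jt.
have := fN (maxn N M) (leq_maxl _ _); have := gM (maxn N M) (leq_maxr _ _).
move: (mean _ f t) (f t) (g t) => A B C /ltW CA AB.
have -> : B - C = - ((C - A) + (A - B)) by zmodule.
by rewrite rnormN (le_trans (rnorm_leD _ _))// (splitr e) lerD.
Qed.

End Increments.

(** * The chirp and uniformly continuous functions *)

Section Cis.
Context {R : realType}.
Implicit Types (a b t x : R).
Local Open Scope complex_scope.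

Definition cis a : R[i] := cos a +i* sin a.

Lemma cisD a b : cis (a + b) = cis a * cis b.
Proof.
rewrite /cis cosD sinD; apply/eqP; rewrite eq_complex/=.
by rewrite eqxx/= addrC.
Qed.

Lemma cis0 : cis 0 = 1.
Proof. by rewrite /cis cos0 sin0. Qed.

Lemma cispi : cis pi = -1.
Proof. by rewrite /cis cospi sinpi; apply/eqP; rewrite eq_complex/= oppr0 !eqxx. Qed.

Lemma cis2pi : cis (pi + pi) = 1.
Proof. by rewrite cisD cispi mulrNN mulr1. Qed.

Lemma cisNpi : cis (- pi) = -1.
Proof.
by rewrite /cis cosN sinN cospi sinpi oppr0; apply/eqP; rewrite eq_complex/= oppr0 !eqxx.
Qed.

Lemma cis_unit a : cis (- a) * cis a = 1.
Proof. by rewrite -cisD addNr cis0. Qed.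

Lemma cmod_cis a : cmod (cis a) = 1.
Proof. by rewrite cmod_sqrt cos2Dsin2 sqrtr1. Qed.

Lemma cmod_leReIm a b : cmod (a +i* b) <= `|a| + `|b|.
Proof.
rewrite cmod_sqrt -[leRHS]ger0_norm ?addr_ge0// -sqrtr_sqr ler_wsqrtr//.
by rewrite sqrrD !real_normK ?num_real// lerD2r lerDl mulrn_wge0// mulr_ge0.
Qed.

Lemma cis_continuous t e : 0 < e -> exists2 d, 0 < d &
  forall s, `|s - t| < d -> cmod (cis s - cis t) < e.
Proof.
move=> e0; have e20 : 0 < e / 2 by rewrite divr_gt0.
have /cvgrPdist_lt/(_ _ e20)[d1 /= d10 fd1] := @continuous_cos R t.
have /cvgrPdist_lt/(_ _ e20)[d2 /= d20 fd2] := @continuous_sin R t.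
exists (Num.min d1 d2); first by rewrite lt_min d10.
move=> s; rewrite lt_min distrC => /andP[/fd1 c1 /fd2 c2].
have -> : cis s - cis t = (cos s - cos t) +i* (sin s - sin t) by [].
rewrite (le_lt_trans (cmod_leReIm _ _))// (splitr e) distrC ltrD//.
by rewrite distrC.
Qed.

Lemma chirpE t : chirp t = cis (t ^+ 2).
Proof. by []. Qed.

Lemma cmod_chirp t : cmod (chirp t) = 1.
Proof. exact: cmod_cis. Qed.

Lemma chirpD t x : chirp (t + x) = chirp t * cis (t * x *+ 2 + x ^+ 2).
Proof. by rewrite !chirpE sqrrD -addrA cisD. Qed.

Lemma cis_sqr_continuous (k t e : R) : 0 < e -> exists2 d, 0 < d &
  forall s, `|s - t| < d -> cmod (cis (k * s ^+ 2) - cis (k * t ^+ 2)) < e.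
Proof.
move=> /(cis_continuous (k * t ^+ 2))[d d0 fd].
have : (fun s : R => k * s ^+ 2) @ t --> k * t ^+ 2.
  by apply: cvgMr; apply: exprn_continuous.
move=> /cvgrPdist_lt/(_ d d0)[r /= r0 fr]; exists r => // s st.
by apply: fd; rewrite distrC; apply: fr; rewrite /= distrC.
Qed.

End Cis.

Section UniformClasses.
Context {R : realType} {X : completeNormedModType R[i]}.
Variables (J : set R) (hJ : J = `[0, +oo[%classic \/ J = setT).
Implicit Types (f g p u v : R -> X).
Local Notation luc := (loc_unif_continuous J).
Local Open Scope complex_scope.

Definition unif_cont f := forall e, 0 < e -> exists2 d, 0 < d &
  forall t x, J t -> 0 <= x <= d -> rnorm (f (t + x) - f t) <= e.

Definition bounded_on f := exists C, forall t, J t -> rnorm (f t) <= C.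

(* UC for b = false, BUC for b = true *)
Definition uc_class (b : bool) f := unif_cont f /\ (b -> bounded_on f).

Lemma unif_cont_luc f : unif_cont f -> luc f.
Proof.
move=> uf a b e Ja e0; have [d d0 fd] := uf e e0; exists d => // t x /andP[at_ _].
exact/fd/(mem_upward hJ Ja).
Qed.

Lemma unif_cont_ext f g : (forall t, J t -> f t = g t) ->
  unif_cont f -> unif_cont g.
Proof.
move=> fg uf e e0; have [d d0 fd] := uf e e0; exists d => // t x Jt /andP[x0 xd].
by rewrite -!fg//; [apply: fd; rewrite ?x0|exact: mem_addr].
Qed.

Lemma bounded_on_ext f g : (forall t, J t -> f t = g t) ->
  bounded_on f -> bounded_on g.
Proof. by move=> fg [C fC]; exists C => t Jt; rewrite -fg// fC. Qed.

Lemma uc_class_ext b f g : (forall t, J t -> f t = g t) ->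
  uc_class b f -> uc_class b g.
Proof.
move=> fg [uf bf]; split; first exact: unif_cont_ext uf.
by move=> /bf; exact: bounded_on_ext.
Qed.

Lemma unif_contB f g : unif_cont f -> unif_cont g -> unif_cont (fun t => f t - g t).
Proof.
move=> uf ug e e0; have e20 : 0 < e / 2 by rewrite divr_gt0.
have [d d0 fd] := uf _ e20; have [c c0 gc] := ug _ e20.
exists (Num.min d c); first by rewrite lt_min d0.
move=> t x Jt /andP[x0]; rewrite le_min => /andP[xd xc].
have := fd t x Jt; have := gc t x Jt; rewrite x0 xd xc => /(_ isT) H2 /(_ isT) H1.
have -> : f (t + x) - g (t + x) - (f t - g t) =
    (f (t + x) - f t) - (g (t + x) - g t) by zmodule.
by rewrite (splitr e) (le_trans (rnorm_leB _ _))// lerD.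
Qed.

Lemma unif_contZ (c : R[i]) f : unif_cont f -> unif_cont (fun t => c *: f t).
Proof.
move=> uf e e0; have c0 := cmod_ge0 c.
have [|d d0 fd] := uf (e / (cmod c + 1)); first by rewrite divr_gt0// ltr_wpDl.
exists d => // t x Jt xd; rewrite -scalerBr rnormZ.
apply: (@le_trans _ _ (cmod c * (e / (cmod c + 1)))).
  by rewrite ler_wpM2l// fd.
rewrite mulrA ler_pdivrMr ?ltr_wpDl// mulrC ler_wpM2l ?(ltW e0)//.
by rewrite lerDl.
Qed.

Lemma bounded_onB f g : bounded_on f -> bounded_on g ->
  bounded_on (fun t => f t - g t).
Proof.
move=> [C fC] [D gD]; exists (C + D) => t Jt.
by rewrite (le_trans (rnorm_leB _ _))// lerD ?fC ?gD.
Qed.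

Lemma bounded_onZ (c : R[i]) f : bounded_on f -> bounded_on (fun t => c *: f t).
Proof.
move=> [C fC]; exists (cmod c * C) => t Jt.
by rewrite rnormZ ler_wpM2l ?cmod_ge0// fC.
Qed.

Lemma bounded_on_shift f s : 0 <= s -> bounded_on f ->
  bounded_on (fun t => f (t + s)).
Proof. by move=> s0 [C fC]; exists C => t Jt; rewrite fC//; exact: mem_addr. Qed.

Lemma unif_cont_shift f s : 0 <= s -> unif_cont f ->
  unif_cont (fun t => f (t + s)).
Proof.
move=> s0 uf e e0; have [d d0 fd] := uf e e0; exists d => // t x Jt xd.
by rewrite addrAC; apply: fd => //; exact: mem_addr.
Qed.

Lemma uc_classB b f g : uc_class b f -> uc_class b g ->
  uc_class b (fun t => f t - g t).
Proof.
move=> [uf bf] [ug bg]; split; first exact: unif_contB.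
by move=> B; apply: bounded_onB; [exact: bf|exact: bg].
Qed.

Lemma uc_classZ b (c : R[i]) f : uc_class b f -> uc_class b (fun t => c *: f t).
Proof.
by move=> [uf bf]; split; [exact: unif_contZ|move=> B; exact/bounded_onZ/bf].
Qed.

Lemma uc_classD b f g : uc_class b f -> uc_class b g ->
  uc_class b (fun t => f t + g t).
Proof.
move=> uf /(uc_classZ (-1))/(uc_classB uf); apply: uc_class_ext => t _.
by rewrite scaleN1r opprK.
Qed.

Lemma uc_class_shift b f s : 0 <= s -> uc_class b f ->
  uc_class b (fun t => f (t + s)).
Proof.
move=> s0 [uf bf]; split; first exact: unif_cont_shift.
by move=> B; exact/bounded_on_shift/bf.
Qed.

Lemma uc_class_BUC b f : unif_cont f -> bounded_on f -> uc_class b f.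
Proof. by move=> uf bf; split. Qed.

Lemma unif_cont_increment_bounded f s : 0 <= s -> unif_cont f ->
  exists C, forall t, J t -> rnorm (f (t + s) - f t) <= C.
Proof.
move=> s0 uf; have [d d0 fd] := uf 1 ltr01.
pose n := Num.bound (s / d).
have sn : s / n.+1%:R <= d.
  rewrite ler_pdivrMr// mulrC -ler_pdivrMr//.
  rewrite (le_trans (ltW (archi_boundP _)))//; first by rewrite divr_ge0// ltW.
  by rewrite ler_nat.
have H (k : nat) t : J t -> rnorm (f (t + k%:R * (s / n.+1%:R)) - f t) <= k%:R.
  elim: k t => [|k IH] t Jt; first by rewrite mul0r addr0 subrr rnorm0.
  have sn0 : 0 <= s / n.+1%:R by rewrite divr_ge0.
  have -> : t + k.+1%:R * (s / n.+1%:R) =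
      (t + k%:R * (s / n.+1%:R)) + s / n.+1%:R.
    by rewrite -natr1 mulrDl mul1r addrA.
  have Jk : J (t + k%:R * (s / n.+1%:R)).
    by apply: mem_addr => //; rewrite mulr_ge0.
  rewrite -(subrKA (f (t + k%:R * (s / n.+1%:R)))) -[k.+1%:R]natr1 [leRHS]addrC.
  rewrite (le_trans (rnorm_leD _ _))// lerD ?IH//.
  by apply: fd; rewrite ?sn0.
exists n.+1%:R => t Jt; have := H n.+1 t Jt.
by rewrite mulrCA divff// mulr1.
Qed.

Lemma luc_bounded_itv p a b : luc p -> exists2 C, 0 <= C &
  forall t, J t -> a <= t <= b -> rnorm (p t) <= C.
Proof.
move=> /(luc_continuous hJ)/continuous_rnormP cp.
have [ab|ba] := leP a b; last first.
  by exists 0 => // t _ /andP[at_ tb]; have := le_lt_trans tb ba; rewrite ltNge at_.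
have : {within `[a, b], continuous (fun t => rnorm (p (retract J t)))}.
  apply: continuous_subspaceT => t; apply/cvgrPdist_lt => e e0.
  have [d d0 pd] := cp t e e0; exists d => //= s st.
  by rewrite (le_lt_trans (rnorm_dist _ _))// rnormB pd// distrC.
move=> /(EVT_max ab)[c _ pc]; exists (rnorm (p (retract J c))).
  exact: rnorm_ge0.
by move=> t Jt tab; have := pc t; rewrite retract_id//; apply; rewrite in_itv.
Qed.

Definition vanishing p := forall e, 0 < e ->
  exists T, forall t, J t -> T <= `|t| -> rnorm (p t) <= e.

Lemma vanishing_bounded p : luc p -> vanishing p -> bounded_on p.
Proof.
move=> lp vp; have [T pT] := vp 1 ltr01.
have [C C0 pC] := luc_bounded_itv (- T) T lp.
exists (C + 1) => t Jt; have [tT|tT] := leP T `|t|.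
  by rewrite (le_trans (pT _ Jt tT))// lerDr.
by rewrite (le_trans (pC _ Jt _)) ?lerDl// -ler_norml ltW.
Qed.

Lemma vanishing_unif_cont p : luc p -> vanishing p -> unif_cont p.
Proof.
move=> lp vp e e0; have e20 : 0 < e / 2 by rewrite divr_gt0.
have [T pT] := vp _ e20.
have [d d0 pd] := lp (retract J (- T - 1)) (T + 1) e (mem_retract hJ _) e0.
exists (Num.min d 1); first by rewrite lt_min d0 ltr01.
move=> t x Jt /andP[x0]; rewrite le_min => /andP[xd x1].
have far s : J s -> T <= `|s| -> rnorm (p s) <= e / 2 by exact: pT.
have Jtx := mem_addr hJ Jt x0.
have [at_|ta] := leP (retract J (- T - 1)) t; last first.
  have tT : t < - T - 1.
    by rewrite ltNge; apply/negP => /(retract_mono hJ); rewrite (retract_id Jt) leNgt ta.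
  rewrite (splitr e) (le_trans (rnorm_leB _ _))// lerD// far//.
    by rewrite -normrN (le_trans _ (ler_norm _))//; lra.
  by rewrite -normrN (le_trans _ (ler_norm _))//; lra.
have [tb|bt] := leP t (T + 1).
  by apply: pd; rewrite ?at_// x0.
rewrite (splitr e) (le_trans (rnorm_leB _ _))// lerD// far//.
  by rewrite (le_trans _ (ler_norm _))//; lra.
by rewrite (le_trans _ (ler_norm _))//; lra.
Qed.

End UniformClasses.

Section MeanClasses.
Context {R : realType} {X : completeNormedModType R[i]}.
Variables (J : set R) (hJ : J = `[0, +oo[%classic \/ J = setT).
Implicit Types (f u v F : R -> X).
Local Notation luc := (loc_unif_continuous J).
Local Open Scope complex_scope.

Lemma luc_cis_sqr (k : R) v : luc v -> luc (fun t => cis (k * t ^+ 2) *: v t).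
Proof. by apply: luc_scale => // t e; exact: cis_sqr_continuous. Qed.

Lemma luc_chirp v : luc v -> luc (fun t => chirp t *: v t).
Proof. by move=> /(luc_cis_sqr 1); apply: luc_ext => // t _; rewrite mul1r. Qed.

Lemma bounded_on_chirp v : bounded_on J v -> bounded_on J (fun t => chirp t *: v t).
Proof.
by move=> [C vC]; exists C => t Jt; rewrite rnormZ cmod_chirp mul1r vC.
Qed.

Lemma unif_cont_mean f h : unif_cont J f -> 0 < h -> unif_cont J (mean h f).
Proof.
move=> uf h0 e e0; have [d d0 fd] := uf e e0; exists d => // t x Jt xd.
have x0 : 0 <= x by case/andP: xd.
apply: (mean_increment hJ (luc_L1loc hJ (unif_cont_luc hJ uf)) Jt x0 h0).
by move=> y /andP[y0 _]; apply: fd => //; exact: mem_addr.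
Qed.

Lemma bounded_on_mean f h : L1loc J f -> bounded_on J f -> 0 < h ->
  bounded_on J (mean h f).
Proof.
move=> fJ [C fC] h0; exists C => t Jt; apply: (mean_le hJ fJ Jt h0).
by move=> s /andP[s0 _]; apply: fC; exact: mem_addr.
Qed.

Lemma uc_class_mean b f h : uc_class J b f -> 0 < h -> uc_class J b (mean h f).
Proof.
move=> [uf bf] h0; split; first exact: unif_cont_mean.
move=> B; apply: bounded_on_mean => //; last exact: bf.
exact/(luc_L1loc hJ)/(unif_cont_luc hJ).
Qed.

Lemma unif_cont_mean_bounded f h : L1loc J f -> bounded_on J f -> 0 < h ->
  unif_cont J (mean h f).
Proof.
move=> fJ [C fC] h0 e e0.
have C0 : 0 <= C.
  by apply: le_trans (rnorm_ge0 _) (fC 0 _); exact: (mem_ge0 hJ).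
have D0 : 0 < C + C + 1 by rewrite ltr_wpDl// addr_ge0.
exists (e * h / (C + C + 1)); first by rewrite !mulr_gt0// invr_gt0.
move=> t x Jt /andP[]; rewrite le_eqVlt => /predU1P[<- _|x0 xd].
  by rewrite addr0 subrr rnorm0 ltW.
have mC s : J s -> rnorm (mean x f s) <= C.
  move=> Js; apply: (mean_le hJ fJ Js x0) => y /andP[y0 _].
  by apply: fC; exact: mem_addr.
rewrite (mean_increment_swap hJ fJ Jt x0 h0) rnormZr ger0_norm; last first.
  by rewrite divr_ge0// ltW.
apply: (@le_trans _ _ (x / h * (C + C))).
  rewrite ler_wpM2l ?divr_ge0 ?(ltW h0) ?(ltW x0)//.
  apply: (le_trans (rnorm_leB _ _)); apply: lerD; apply: mC => //.
  exact: (mem_addr hJ Jt (ltW h0)).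
rewrite mulrAC ler_pdivrMr//; rewrite ler_pdivlMr// in xd.
by apply: le_trans xd; rewrite ler_wpM2l ?(ltW x0)// lerDl.
Qed.

Definition chirp_class b F := exists u v, [/\ uc_class J b u, unif_cont J v,
  bounded_on J v & forall t, J t -> F t = u t + chirp t *: v t].

Lemma chirp_class_luc b F : chirp_class b F -> luc F.
Proof.
move=> [u [v [[uu _] uv _ FE]]].
apply: (luc_ext hJ (f := fun t => u t + chirp t *: v t)) => [t Jt|].
  by rewrite FE.
apply: (lucD hJ); first exact: unif_cont_luc.
exact/luc_chirp/(unif_cont_luc hJ).
Qed.

Lemma uc_class_mean_chirp b F h : chirp_class b F -> 0 < h ->
  uc_class J b (mean h F).
Proof.
move=> /[dup] /chirp_class_luc/(luc_L1loc hJ) FJ [u [v [uu uv bv FE]]] h0.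
have lu := luc_L1loc hJ (unif_cont_luc hJ uu.1).
have lg := luc_L1loc hJ (luc_chirp (unif_cont_luc hJ uv)).
apply: (uc_class_ext hJ (f := fun t => mean h u t + mean h (fun t => chirp t *: v t) t)).
  move=> t Jt; apply/esym; apply: (meanE hJ FJ Jt h0).
  have := has_meanD (has_mean_mean hJ lu Jt h0) (has_mean_mean hJ lg Jt h0).
  apply: has_mean_ext => s /andP[s0 _]; rewrite FE//; exact: mem_addr.
apply: uc_classD => //; first exact: uc_class_mean.
apply: uc_class_BUC; first exact: unif_cont_mean_bounded (bounded_on_chirp bv) h0.
exact: bounded_on_mean (bounded_on_chirp bv) h0.
Qed.

Lemma uc_class_chirp b F : uc_class J b F -> chirp_class b F.
Proof.
move=> uF; exists F, (fun=> 0); split=> //.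
- by move=> e e0; exists 1 => // t x _ _; rewrite subrr rnorm0 ltW.
- by exists 0 => t _; rewrite rnorm0.
- by move=> t _; rewrite scaler0 addr0.
Qed.

Lemma mean_differenceE f s t h : L1loc J f -> J t -> 0 <= s -> 0 < h ->
  has_mean h (fun y => difference s f (t + y)) (mean h f (t + s) - mean h f t).
Proof.
move=> fJ Jt s0 h0.
have := has_meanB (has_mean_mean hJ fJ (mem_addr hJ Jt s0) h0)
  (has_mean_mean hJ fJ Jt h0).
by apply: has_mean_ext => y _; rewrite /difference addrAC.
Qed.

Lemma luc_difference f s : luc f -> 0 <= s -> luc (difference s f).
Proof. by move=> lf s0; apply: (lucB hJ) => //; exact: luc_shift. Qed.

Lemma uc_class_mean_difference b f s h : luc f -> 0 < s -> 0 < h ->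
  chirp_class b (difference s f) ->
  uc_class J b (fun t => mean h f (t + s) - mean h f t).
Proof.
move=> lf s0 h0 cf.
apply: (uc_class_ext hJ (f := mean h (difference s f))); last first.
  exact: uc_class_mean_chirp.
move=> t Jt; apply: (meanE hJ _ Jt h0).
  exact/(luc_L1loc hJ)/luc_difference/ltW.
exact: mean_differenceE (luc_L1loc hJ lf) Jt (ltW s0) h0.
Qed.

Lemma mean_additive f t h k : L1loc J f -> J t -> 0 < h -> 0 < k ->
  (h + k)%:C *: mean (h + k) f t = h%:C *: mean h f t + k%:C *: mean k f (t + h).
Proof.
move=> fJ Jt h0 k0; have hk0 : 0 < h + k by rewrite addr_gt0.
have H := has_mean_itvD (ltW h0) (ltW k0) (has_mean_mean hJ fJ Jt h0).
have E : has_mean k (fun s => f (t + (h + s))) (mean k f (t + h)).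
  have := has_mean_mean hJ fJ (mem_addr hJ Jt (ltW h0)) k0.
  by apply: has_mean_ext => s _; rewrite addrA.
have M := measurable_itv `[0, h + k].
have muM := lebesgue_measure_itvcc_lty 0 (h + k).
have E' := has_mean_mean hJ fJ Jt hk0.
exact: (has_bochner_integral_unique (mu := @lebesgue_measure R) M muM E' (H _ E)).
Qed.

Lemma uc_class_mean_multiple b f c n : luc f -> 0 < c ->
  (forall s, 0 < s -> chirp_class b (difference s f)) ->
  uc_class J b (fun t => mean (n.+1%:R * c) f t - mean c f t).
Proof.
move=> lf c0 df; have fJ := luc_L1loc hJ lf.
have : uc_class J b (fun t =>
    n.+1%:R%:C *: (mean (n.+1%:R * c) f t - mean c f t)).
  elim: n => [|n IH].
    apply: (uc_class_ext hJ (f := fun=> 0)) => [t Jt|].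
      by rewrite mul1r subrr scaler0.
    split=> [e e0|_]; last by exists 0 => t _; rewrite rnorm0.
    by exists 1 => // t x _ _; rewrite subrr rnorm0 ltW.
  have nc0 : 0 < n.+1%:R * c by rewrite mulr_gt0.
  have D := uc_class_mean_difference lf nc0 c0 (df _ nc0).
  have := uc_classD hJ IH D.
  apply: (uc_class_ext hJ) => t Jt.
  have := mean_additive fJ Jt nc0 c0.
  have -> : n.+1%:R * c + c = n.+2%:R * c by rewrite -[n.+2%:R]natr1 mulrDl mul1r.
  set A := mean (n.+2%:R * c) f t; set B := mean (n.+1%:R * c) f t.
  move: (mean c f t) (mean c f (t + _)) A B => C D' A B.
  have c0' : c%:C != 0 by rewrite eq_complex/= eqxx andbT gt_eqF.
  rewrite !rmorphM/= -!scalerA ![_ *: (c%:C *: _)]scalerA ![_%:C * c%:C]mulrC.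
  rewrite -!scalerA -scalerDr => /(scalerI c0') AE.
  rewrite [RHS]scalerBr AE -[n.+2%:R]natr1 rmorphD/= scalerDl scale1r scalerBr.
  by move: (_ *: B) (_ *: C) => *; zmodule.
move=> /(uc_classZ (n.+1%:R^-1)%:C); apply: (uc_class_ext hJ) => t Jt.
by rewrite scalerA -rmorphM/= mulVf// scale1r.
Qed.

End MeanClasses.

(** * Differences in U + g V *)

Section BoundedPart.
Context {R : realType} {X : completeNormedModType R[i]}.
Variables (J : set R) (hJ : J = `[0, +oo[%classic \/ J = setT).
Implicit Types (f u v : R -> X).
Local Open Scope complex_scope.

(* With e_s(t) = chirp (t + s) / chirp t, the cocycle identity for f shows that
   B(t) = (1 - e_s(t)) v(t) - (1 - e_r(t)) v'(t) is bounded for s = r / 2.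
   Replacing t by t + pi / r fixes e_r and changes the sign of e_s, so that
   B(t + pi / r) - B(t) equals 2 e_s(t) v(t) up to a bounded function. *)
Lemma chirp_part_bounded f u v u' v' r : 0 < r ->
  unif_cont J u -> unif_cont J v -> unif_cont J u' -> unif_cont J v' ->
  (forall t, J t -> difference r f t = u t + chirp t *: v t) ->
  (forall t, J t -> difference (r / 2) f t = u' t + chirp t *: v' t) ->
  bounded_on J v.
Proof.
move=> r0 uu uv uu' uv' fu fu'.
pose s := r / 2; have s0 : 0 < s by rewrite divr_gt0.
pose tau := pi / r; have tau0 : 0 < tau by rewrite divr_gt0// pi_gt0.
pose e (q t : R) : R[i] := cis (t * q *+ 2 + q ^+ 2).
have e1 q t : cmod (e q t) = 1 by exact: cmod_cis.
pose B t := (1 - e s t) *: v t - (1 - e r t) *: v' t.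
have [C1 uC] := unif_cont_increment_bounded hJ (ltW s0) uu.
have [C2 uC'] := unif_cont_increment_bounded hJ (ltW r0) uu'.
have [C3 vC] := unif_cont_increment_bounded hJ (ltW s0) uv.
have [C4 vC'] := unif_cont_increment_bounded hJ (ltW r0) uv'.
have [C5 vC5] := unif_cont_increment_bounded hJ (ltW tau0) uv.
have [C6 vC6] := unif_cont_increment_bounded hJ (ltW tau0) uv'.
have BC t : J t -> rnorm (B t) <= (C1 + C2) + (C3 + C4).
  move=> Jt; have Jts := mem_addr hJ Jt (ltW s0); have Jtr := mem_addr hJ Jt (ltW r0).
  have cocycle : difference r f (t + s) + difference s f t =
      difference s f (t + r) + difference r f t.
    by rewrite /difference [t + r + s]addrAC; move: (f _) (f _) (f _) (f _) => *; zmodule.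
  move: cocycle; rewrite !fu// !fu'// !chirpD -/(e s t) -/(e r t) -!scalerA => E.
  have BE : chirp t *: B t = (u (t + s) - u t) - (u' (t + r) - u' t) +
      chirp t *: (e s t *: (v (t + s) - v t) - e r t *: (v' (t + r) - v' t)).
    move: E; rewrite /B !(scalerBr, scalerBl, scale1r).
    move: (u _) (u _) (u' _) (u' _) => a b c d.
    move: (_ *: v _) (_ *: (_ *: v _)) (_ *: (_ *: v _)) => g1 g2 g3.
    move: (_ *: v' _) (_ *: (_ *: v' _)) (_ *: (_ *: v' _)) => h1 h2 h3 E.
    apply/eqP; rewrite -subr_eq0; apply/eqP.
    by rewrite -[RHS](subrr (b + g3 + (d + h1))) {1}E; zmodule.
  rewrite -[rnorm (B t)]mul1r -(cmod_chirp t) -rnormZ BE.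
  rewrite (le_trans (rnorm_leD _ _))// lerD//.
    by rewrite (le_trans (rnorm_leB _ _))// lerD// ?uC ?uC'.
  rewrite rnormZ cmod_chirp mul1r (le_trans (rnorm_leB _ _))//.
  by rewrite !rnormZ !e1 !mul1r lerD// ?vC ?vC'.
set K := (C1 + C2) + (C3 + C4) in BC.
exists ((K + K + 2 * C5 + 2 * C6) / 2) => t Jt.
have Jtt := mem_addr hJ Jt (ltW tau0).
have es : e s (t + tau) = - e s t.
  rewrite /e (_ : (t + tau) * s *+ 2 + s ^+ 2 = (t * s *+ 2 + s ^+ 2) + pi).
    by rewrite cisD cispi mulrN1.
  rewrite /tau /s; field; lra.
have er : e r (t + tau) = e r t.
  rewrite /e (_ : (t + tau) * r *+ 2 + r ^+ 2 = (t * r *+ 2 + r ^+ 2) + (pi + pi)).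
    by rewrite cisD cis2pi mulr1.
  rewrite /tau; field; lra.
have E : 2%:C *: (e s t *: v t) = B (t + tau) - B t -
    (1 + e s t) *: (v (t + tau) - v t) + (1 - e r t) *: (v' (t + tau) - v' t).
  have -> : 2%:C *: (e s t *: v t) = (1 + e s t) *: v t - (1 - e s t) *: v t.
    rewrite scalerA -scalerBl; congr (_ *: _).
    by rewrite (rmorph_nat (real_complex R)); ring.
  rewrite /B es er opprK !scalerBr.
  by do ![move: (_ *: v _) => ?]; do ![move: (_ *: v' _) => ?]; zmodule.
have c1 : cmod (1 : R[i]) = 1 by rewrite -cis0 cmod_cis.
have ces : cmod (1 + e s t) <= 2.
  by rewrite (le_trans (cmod_leD _ _))// c1 e1; lra.
have cer : cmod (1 - e r t) <= 2.
  by rewrite (le_trans (cmod_leD _ _))// cmodN c1 e1; lra.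
rewrite ler_pdivlMr// mulrC.
have -> : 2 * rnorm (v t) = rnorm (2%:C *: (e s t *: v t)).
  by rewrite rnormZr rnormZ e1 mul1r ger0_norm.
rewrite E (le_trans (rnorm_leD _ _))// lerD//.
  rewrite (le_trans (rnorm_leB _ _))// lerD//.
    by rewrite (le_trans (rnorm_leB _ _))// lerD// BC.
  by rewrite rnormZ ler_pM ?cmod_ge0 ?rnorm_ge0// vC5.
by rewrite rnormZ ler_pM ?cmod_ge0 ?rnorm_ge0// vC6.
Qed.

End BoundedPart.

Section Evaluations.
Context {R : realType} {X : completeNormedModType R[i]}.
Implicit Types (F G : R -> X) (L : seq (R[i] * R)) (J : set R).
Local Open Scope complex_scope.

Definition lin L F : X := \sum_(p <- L) p.1 *: F p.2.

Definition lin_opp L : seq (R[i] * R) := [seq (- p.1, p.2) | p <- L].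

Lemma lin_sub L L' F : lin (L ++ lin_opp L') F = lin L F - lin L' F.
Proof.
rewrite /lin big_cat/= big_map; congr (_ + _).
by rewrite -sumrN; apply: eq_bigr => p _; rewrite scaleNr.
Qed.

Lemma linB L F G : lin L (fun t => F t - G t) = lin L F - lin L G.
Proof. by rewrite /lin -sumrB; apply: eq_bigr => p _; rewrite scalerBr. Qed.

Definition supported J L := forall p, p \in L -> J p.2.

Lemma supported_cons J p L : supported J (p :: L) -> J p.2 /\ supported J L.
Proof.
move=> H; split=> [|q qL]; first by apply: H; rewrite inE eqxx.
by apply: H; rewrite inE qL orbT.
Qed.

Lemma lin_ext J L F G : supported J L -> (forall t, J t -> F t = G t) ->
  lin L F = lin L G.
Proof.
by move=> LJ FG; apply: eq_big_seq => p /LJ Jp; rewrite FG.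
Qed.

Lemma lin_luc J K L (F : R -> R -> X) :
  K = `[0, +oo[%classic \/ K = setT -> supported J L ->
  (forall t, J t -> loc_unif_continuous K (F t)) ->
  loc_unif_continuous K (fun s => lin L (fun t => F t s)).
Proof.
move=> hK; elim: L => [|p L IH] LJ lF.
  apply: (luc_ext hK (f := fun=> 0)) => [s _|]; first by rewrite /lin big_nil.
  by apply: luc_everywhere => // s; exact: cvg_cst.
have [Jp {}LJ] := supported_cons LJ.
apply: (luc_ext hK (f := fun s => p.1 *: F p.2 s + lin L (fun t => F t s))).
  by move=> s _; rewrite /lin big_cons.
by apply: (lucD hK); [exact/lucZ/lF|exact: IH].
Qed.

Lemma lin_mean J L c (F : R -> R -> X) (M : R -> X) : 0 < c -> supported J L ->
  (forall t, J t -> has_mean c (F t) (M t)) ->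
  has_mean c (fun s => lin L (fun t => F t s)) (lin L M).
Proof.
move=> c0; elim: L => [|p L IH] LJ FM.
  rewrite [lin [::] M]big_nil; apply: has_mean_ext (has_mean_cst 0 (ltW c0)).
  by move=> s _; rewrite /lin big_nil.
have [Jp {}LJ] := supported_cons LJ.
rewrite [lin (p :: L) M]big_cons.
apply: has_mean_ext (has_meanD (has_meanZ p.1 (FM _ Jp)) (IH LJ FM)) => s _.
by rewrite [RHS]big_cons.
Qed.

End Evaluations.

Section HalfPeriod.
Context {R : realType} {X : completeNormedModType R[i]}.
Variables (J : set R) (hJ : J = `[0, +oo[%classic \/ J = setT).
Implicit Types (f u v F : R -> X) (t x : R).
Local Notation luc := (loc_unif_continuous J).
Local Open Scope complex_scope.

(* A half period of the chirp at t, for |t| >= 1. *)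
Definition half_period t : R := pi / (2 * Num.max 1 `|t|).

Let max0 t : 0 < Num.max 1 `|t|.
Proof. by rewrite lt_max ltr01. Qed.

Lemma half_period_gt0 t : 0 < half_period t.
Proof. by rewrite divr_gt0 ?pi_gt0// mulr_gt0. Qed.

Lemma half_period_continuous : continuous half_period.
Proof.
move=> t; apply: cvgM; first exact: cvg_cst.
apply: cvgV; first by rewrite gt_eqF// mulr_gt0.
apply: cvgM; first exact: cvg_cst.
apply: (@continuous_max _ _ (fun=> 1) (fun t : R => `|t|)).
  exact: cvg_cst.
exact: norm_continuous.
Qed.

Lemma half_period_small e : 0 < e ->
  exists T, forall t, T <= `|t| -> half_period t <= e.
Proof.
move=> e0; exists (pi / e) => t tT.
rewrite ler_pdivrMr ?mulr_gt0// mulrC -ler_pdivrMr//.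
have tM : `|t| <= Num.max 1 `|t| by rewrite le_max lexx orbT.
by have := le_trans tT tM; have := max0 t; lra.
Qed.

Lemma chirp_half_period t : 1 <= `|t| ->
  chirp (t + half_period t) = - (chirp t * cis (half_period t ^+ 2)).
Proof.
move=> t1; rewrite chirpD cisD mulrA.
have -> : cis (t * half_period t *+ 2) = -1.
  rewrite /half_period max_r//; have [t0|t0] := leP 0 t.
    rewrite ger0_norm// in t1 *.
    rewrite (_ : t * _ *+ 2 = pi) ?cispi//; field; lra.
  rewrite ltr0_norm// in t1 *.
  rewrite (_ : t * _ *+ 2 = - pi) ?cisNpi//; field; lra.
by rewrite mulrN1 mulNr.
Qed.

Definition slow_part t : seq (R[i] * R) :=
  [:: ((2^-1)%:C, t); ((2^-1)%:C, t + half_period t)].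

Definition chirp_part t : seq (R[i] * R) :=
  [:: ((2^-1)%:C * cis (- t ^+ 2), t);
      (- ((2^-1)%:C * cis (- t ^+ 2)), t + half_period t)].

Lemma lin_slow_part t F :
  lin (slow_part t) F = (2^-1)%:C *: F t + (2^-1)%:C *: F (t + half_period t).
Proof. by rewrite /lin !big_cons big_nil addr0. Qed.

Lemma lin_chirp_part t F : lin (chirp_part t) F =
  (2^-1)%:C *: (cis (- t ^+ 2) *: F t - cis (- t ^+ 2) *: F (t + half_period t)).
Proof.
rewrite /lin !big_cons big_nil addr0/= scaleNr -!scalerA.
by rewrite -scalerBr.
Qed.

Lemma chirp_conj t : chirp t * cis (- t ^+ 2) = 1.
Proof. by rewrite mulrC chirpE cis_unit. Qed.

Lemma half_double (x : X) : (2^-1)%:C *: x + (2^-1)%:C *: x = x.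
Proof.
rewrite -scalerDl -rmorphD/= (_ : 2^-1 + 2^-1 = 1) ?scale1r//.
by field.
Qed.

Lemma slow_chirp_decomposition t F :
  F t = lin (slow_part t) F + chirp t *: lin (chirp_part t) F.
Proof.
rewrite lin_slow_part lin_chirp_part -[F t in LHS]half_double.
rewrite (scalerA (chirp t)) [chirp t * _]mulrC -scalerA scalerBr !(scalerA (chirp t)).
rewrite chirp_conj !scale1r scalerBr.
by move: (_ *: F t) (_ *: F (t + _)) => A B; rewrite addrACA subrr addr0.
Qed.

Lemma supported_slow_part t : J t -> supported J (slow_part t).
Proof.
move=> Jt p; rewrite !inE => /orP[/eqP ->//|/eqP -> /=].
exact: (mem_addr hJ Jt (ltW (half_period_gt0 t))).
Qed.

Lemma supported_chirp_part t : J t -> supported J (chirp_part t).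
Proof.
move=> Jt p; rewrite !inE => /orP[/eqP ->//|/eqP -> /=].
exact: (mem_addr hJ Jt (ltW (half_period_gt0 t))).
Qed.

Lemma luc_half_period F : luc F -> luc (fun t => F (t + half_period t)).
Proof.
apply: (luc_comp hJ (y := fun t => t + half_period t)) => [t Jt|t].
  exact: (mem_addr hJ Jt (ltW (half_period_gt0 t))).
by apply: cvgD; [exact: cvg_id|exact: half_period_continuous].
Qed.

Lemma luc_chirp_part F : luc F -> luc (fun t => lin (chirp_part t) F).
Proof.
move=> lF; apply: (luc_ext hJ (f := fun t => (2^-1)%:C *:
    (cis (-1 * t ^+ 2) *: F t - cis (-1 * t ^+ 2) *: F (t + half_period t)))).
  by move=> t _; rewrite lin_chirp_part mulN1r.
apply: (lucZ hJ); apply: (lucB hJ); first exact: luc_cis_sqr.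
exact/luc_cis_sqr/luc_half_period.
Qed.

Lemma half_period_increment u : unif_cont J u ->
  vanishing J (fun t => u (t + half_period t) - u t).
Proof.
move=> uu e e0; have [d d0 ud] := uu e e0.
have [T HT] := half_period_small d0; exists T => t Jt tT.
by apply: ud => //; rewrite (ltW (half_period_gt0 t)) HT.
Qed.

(* The half period turns chirp t into almost - chirp t, so that the half
   difference at t and t + half_period t isolates v and cancels u. *)
Lemma vanishing_chirp_part u v F : unif_cont J u -> unif_cont J v ->
  bounded_on J v -> (forall t, J t -> F t = u t + chirp t *: v t) ->
  vanishing J (fun t => v t - lin (chirp_part t) F).
Proof.
move=> uu uv [C vC] FE e e0.
have C0 : 0 <= C by apply: le_trans (rnorm_ge0 _) (vC 0 _); exact: (mem_ge0 hJ).
have e30 : 0 < e / 3 by rewrite divr_gt0.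
have e40 : 0 < e / 3 / (C + 1) by rewrite divr_gt0// ltr_wpDl.
have [T1 uT] := half_period_increment uu e30.
have [T2 vT] := half_period_increment uv e30.
have [d d0 cd] := cis_continuous 0 e40.
have [T3 yT] := half_period_small (e := Num.min 1 (d / 2))
  ltac:(by rewrite lt_min ltr01 divr_gt0).
exists (Num.max 1 (Num.max T1 (Num.max T2 T3))) => t Jt.
rewrite !ge_max => /and4P[t1 tT1 tT2 tT3].
set y := half_period t; have y0 : 0 < y := half_period_gt0 t.
have Jty := mem_addr hJ Jt (ltW y0).
have := yT t tT3; rewrite -/y le_min => /andP[y1 yd].
have cy : cmod (cis (y ^+ 2) - 1) <= e / 3 / (C + 1).
  rewrite -(cis0 (R := R)) ltW// cd// subr0 ger0_norm ?sqr_ge0//.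
  by rewrite (@le_lt_trans _ _ y)//; [rewrite expr2 ger_pMl//|lra].
have E : v t - lin (chirp_part t) F = (2^-1)%:C *: (
    cis (- t ^+ 2) *: (u (t + y) - u t) - (v (t + y) - v t)
    - (cis (y ^+ 2) - 1) *: v (t + y)).
  have vE : v t = (2^-1)%:C *: (v t + v t) by rewrite scalerDr half_double.
  rewrite {1}vE lin_chirp_part -/y -scalerBr; congr (_ *: _).
  rewrite !FE// chirp_half_period// -/y.
  have cg : cis (- t ^+ 2) * chirp t = 1 by rewrite mulrC chirp_conj.
  rewrite [cis _ *: (u t + _)]scalerDr [cis _ *: (u (t + y) + _)]scalerDr.
  rewrite !scalerA mulrN mulrA cg mul1r scale1r scaleNr scalerBr scalerBl scale1r.
  move: (cis (- t ^+ 2) *: u t) (cis (- t ^+ 2) *: u (t + y)) => a b.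
  move: (_ *: v (t + y)) => k; move: (v t) (v (t + y)) => p q.
  have -> : p + p - (a + p - (b - k)) = p - a + b - k by zmodule.
  by zmodule.
rewrite E rnormZr ger0_norm//.
have : rnorm (cis (- t ^+ 2) *: (u (t + y) - u t) - (v (t + y) - v t)
    - (cis (y ^+ 2) - 1) *: v (t + y)) <= e / 3 + e / 3 + e / 3.
  apply: (le_trans (rnorm_leB _ _)); apply: lerD; last first.
    rewrite rnormZ (@le_trans _ _ (e / 3 / (C + 1) * C))//.
      by rewrite ler_pM ?cmod_ge0 ?rnorm_ge0// vC.
    rewrite mulrAC ler_pdivrMr ?ltr_wpDl// ler_wpM2l ?(ltW e30)//.
    by rewrite lerDl.
  apply: (le_trans (rnorm_leB _ _)); apply: lerD; last exact: vT.
  by rewrite rnormZ cmod_cis mul1r; exact: uT.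
by lra.
Qed.

End HalfPeriod.

Section DifferenceProperty.
Context {R : realType} {X : completeNormedModType R[i]}.
Variables (J : set R) (hJ : J = `[0, +oo[%classic \/ J = setT) (b : bool).
Implicit Types (f u v F G : R -> X) (t x e : R).
Local Notation luc := (loc_unif_continuous J).
Local Open Scope complex_scope.

Lemma chirp_class_parts F : chirp_class J b F ->
  [/\ unif_cont J (fun t => lin (chirp_part t) F),
      bounded_on J (fun t => lin (chirp_part t) F) &
      uc_class J b (fun t => lin (slow_part t) F)].
Proof.
move=> cF; have lF := chirp_class_luc hJ cF.
have [u [v [uu uv bv FE]]] := cF.
pose p t := v t - lin (chirp_part t) F.
have vp : vanishing J p by exact: vanishing_chirp_part uu.1 uv bv FE.
have lp : luc p.
  apply: (lucB hJ); first exact: unif_cont_luc.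
  exact: luc_chirp_part.
have vgp : vanishing J (fun t => chirp t *: p t).
  move=> e /vp[T pT]; exists T => t Jt tT.
  by rewrite rnormZ cmod_chirp mul1r pT.
have lgp := luc_chirp hJ lp.
have pE t : lin (chirp_part t) F = v t - p t by rewrite opprB addrC subrK.
split.
- apply: (unif_cont_ext hJ (f := fun t => v t - p t)) => [t _|].
    by rewrite pE.
  by apply: unif_contB => //; exact: vanishing_unif_cont.
- apply: (bounded_on_ext (f := fun t => v t - p t)) => [t _|].
    by rewrite pE.
  by apply: bounded_onB => //; exact: vanishing_bounded.
apply: (uc_class_ext hJ (f := fun t => u t + chirp t *: p t)) => [t Jt|].
  have := slow_chirp_decomposition t F; rewrite FE// pE scalerBr.
  move: (_ *: v t) (_ *: p t) (lin _ _) => A B C E.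
  have -> : u t = C + (A - B) - A by rewrite -E addrK.
  by zmodule.
apply: (uc_classD hJ) => //; apply: uc_class_BUC.
  exact: vanishing_unif_cont.
exact: vanishing_bounded.
Qed.

(* The bounds that express, at scale 1 / (n + 1), that F is in the class up to
   an oscillation e. *)
Inductive test e (n : nat) : seq (R[i] * R) -> R -> Prop :=
| test_chirp_osc t x of J t & 0 <= x <= n.+1%:R^-1 :
    test e n (chirp_part (t + x) ++ lin_opp (chirp_part t)) e
| test_slow_osc t x of J t & 0 <= x <= n.+1%:R^-1 :
    test e n (slow_part (t + x) ++ lin_opp (slow_part t)) e
| test_chirp_bound t of J t : test e n (chirp_part t) n%:R
| test_slow_bound t of b & J t : test e n (slow_part t) n%:R.

Definition tame e n F := forall L C, test e n L C -> rnorm (lin L F) <= C.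

Lemma supported_cat_opp L L' :
  supported J L -> supported J L' -> supported J (L ++ lin_opp L').
Proof.
move=> LJ LJ' p; rewrite mem_cat => /orP[/LJ//|/mapP[q qL ->]/=].
exact: LJ' qL.
Qed.

Lemma test_supported e n L C : test e n L C -> supported J L.
Proof.
case=> [t x Jt /andP[x0 _]|t x Jt /andP[x0 _]|t Jt|t _ Jt].
- by apply: supported_cat_opp; apply: (supported_chirp_part hJ) => //; exact: mem_addr.
- by apply: supported_cat_opp; apply: (supported_slow_part hJ) => //; exact: mem_addr.
- exact: supported_chirp_part.
- exact: supported_slow_part.
Qed.

Lemma tame_ext e n F G : (forall t, J t -> F t = G t) -> tame e n F -> tame e n G.
Proof.
move=> FG TF L C LC; rewrite -(lin_ext (test_supported LC) FG); exact: TF.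
Qed.

Lemma tameB e e' n m F G : tame e n F -> tame e' m G ->
  tame (e + e') (n + m)%N (fun t => F t - G t).
Proof.
move=> TF TG.
have mono (k l : nat) x : (k <= l)%N -> 0 <= x <= l.+1%:R^-1 -> 0 <= x <= k.+1%:R^-1.
  move=> kl /andP[-> xl]/=; rewrite (le_trans xl)//.
  by rewrite lef_pV2 ?posrE// ler_nat ltnS.
move=> L C; case=> [t x Jt xs|t x Jt xs|t Jt|t bT Jt].
- rewrite linB (le_trans (rnorm_leB _ _))// lerD//.
    by apply: TF; apply: test_chirp_osc => //; exact: mono (leq_addr _ _) xs.
  by apply: TG; apply: test_chirp_osc => //; exact: mono (leq_addl _ _) xs.
- rewrite linB (le_trans (rnorm_leB _ _))// lerD//.
    by apply: TF; apply: test_slow_osc => //; exact: mono (leq_addr _ _) xs.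
  by apply: TG; apply: test_slow_osc => //; exact: mono (leq_addl _ _) xs.
- rewrite linB natrD (le_trans (rnorm_leB _ _))// lerD//.
    by apply: TF; exact: test_chirp_bound.
  by apply: TG; exact: test_chirp_bound.
rewrite linB natrD (le_trans (rnorm_leB _ _))// lerD//.
  by apply: TF; exact: test_slow_bound.
by apply: TG; exact: test_slow_bound.
Qed.

Lemma tame_chirp_class F : (forall e, 0 < e -> exists n, tame e n F) ->
  chirp_class J b F.
Proof.
move=> TF; exists (fun t => lin (slow_part t) F), (fun t => lin (chirp_part t) F).
have inv0 (n : nat) : 0 < n.+1%:R^-1 :> R by rewrite invr_gt0.
split.
- split=> [e /TF[n Tn]|bT].
    exists n.+1%:R^-1 => // t x Jt xn; rewrite -lin_sub.
    by apply: Tn; exact: test_slow_osc.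
  have [n Tn] := TF 1 ltr01; exists n%:R => t Jt.
  by apply: Tn; exact: test_slow_bound.
- move=> e /TF[n Tn]; exists n.+1%:R^-1 => // t x Jt xn; rewrite -lin_sub.
  by apply: Tn; exact: test_chirp_osc.
- have [n Tn] := TF 1 ltr01; exists n%:R => t Jt.
  by apply: Tn; exact: test_chirp_bound.
by move=> t Jt; exact: slow_chirp_decomposition.
Qed.

Lemma chirp_class_tame F e : chirp_class J b F -> 0 < e -> exists n, tame e n F.
Proof.
move=> /chirp_class_parts[uv [C vC] [us bs]] e0.
have [d d0 vd] := uv e e0; have [c c0 sc] := us e e0.
have [D sD] : exists D, b -> forall t, J t -> rnorm (lin (slow_part t) F) <= D.
  by case: (b) bs => [/(_ isT)[D sD]|_]; [exists D|exists 0].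
have [n1] := exists_invS_le (e := Num.min d c) ltac:(by rewrite lt_min d0 c0).
rewrite le_min => /andP[nd nc].
pose n := maxn n1 (maxn (Num.bound `|C|) (Num.bound `|D|)); exists n.
have inn : n.+1%:R^-1 <= n1.+1%:R^-1 :> R.
  by rewrite lef_pV2 ?posrE// ler_nat ltnS leq_maxl.
have bound_le (y : R) : (Num.bound `|y| <= n)%N -> y <= n%:R.
  move=> yn; rewrite (le_trans (ler_norm _))// (le_trans (ltW (archi_boundP _)))//.
  by rewrite ler_nat.
move=> L K; case=> [t x Jt /andP[x0 xs]|t x Jt /andP[x0 xs]|t Jt|t bT Jt].
- by rewrite lin_sub; apply: vd => //; rewrite x0 (le_trans xs)// (le_trans inn).
- by rewrite lin_sub; apply: sc => //; rewrite x0 (le_trans xs)// (le_trans inn).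
- rewrite (le_trans (vC t Jt))// bound_le// /n.
  by rewrite !leq_max leqnn orbT.
rewrite (le_trans (sD bT t Jt))// bound_le// /n.
by rewrite !leq_max leqnn !orbT.
Qed.

Variable f : R -> X.
Hypotheses (lf : luc f)
  (df : forall s, 0 < s -> chirp_class J b (difference s f)).

Lemma tame_differences e : 0 < e ->
  exists n s c, [/\ 1 <= s, 0 < c &
    forall x, 0 <= x <= c -> tame e n (difference (s + x) f)].
Proof.
move=> e0.
apply: (baire_interval (P := fun n s => tame e n (difference s f)))
  => [n s s12 Ps|s s12]; last first.
  by apply: chirp_class_tame => //; apply: df; lra.
move=> L C LC; have LJ := test_supported LC.
pose H : set R := `[0, +oo[%classic.
have hH : H = `[0, +oo[%classic \/ H = setT by left.
have HE y : 0 <= y -> H y by move=> y0; rewrite /H/= in_itv/= y0.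
have lL : loc_unif_continuous H (fun s => lin L (difference s f)).
  apply: (lin_luc (F := fun t s => difference s f t) hH LJ) => t Jt.
  apply: (lucB hH); last by apply: luc_everywhere => // y; exact: cvg_cst.
  move=> p q r Hp r0.
  have p0 : 0 <= p by move: Hp; rewrite /H/= in_itv/= andbT.
  have [d d0 fd] := lf (t + q) (mem_addr hJ Jt p0) r0; exists d => // y x yp xd.
  by rewrite addrA; apply: fd => //; rewrite !lerD2l.
apply/ler_addgt0Pr => r r0.
have s0 : 0 <= s by lra.
have [d d0 Ld] := luc_near hH lL (HE s s0) r0.
have [s' [s'12 ss' Ps']] := Ps d d0.
have s'0 : 0 <= s' by lra.
have := Ld s' (HE s' s'0) ss'; have := Ps' L C LC.
set A := lin L (difference s' f); set B := lin L (difference s f) => AC AB.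
rewrite -[B](subrK A) addrC (le_trans (rnorm_leD _ _))// lerD//.
by rewrite rnormB.
Qed.

Lemma mean_difference_chirp_class h : 0 < h ->
  chirp_class J b (fun t => f t - mean h f t).
Proof.
move=> h0; apply: tame_chirp_class => e e0.
have fJ := luc_L1loc hJ lf.
have e20 : 0 < e / 2 by rewrite divr_gt0.
have [n [s [c0 [s1 c00 Tn]]]] := tame_differences e20.
have s0 : 0 < s by lra.
have [N Nc] := exists_invS_le (e := c0 / h) ltac:(by rewrite divr_gt0).
pose c := h / N.+1%:R.
have c_gt0 : 0 < c by rewrite divr_gt0.
have cc0 : c <= c0 by rewrite /c mulrC -ler_pdivlMr.
have hc : h = N.+1%:R * c by rewrite /c mulrCA divff// mulr1.
pose Z t := mean c f (t + s) - f t.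
have TZ : tame (e / 2) n Z.
  move=> L C LC; have LJ := test_supported LC.
  have Zm t : J t -> has_mean c (fun x => difference (s + x) f t) (Z t).
    move=> Jt; have := has_meanB (has_mean_mean hJ fJ (mem_addr hJ Jt (ltW s0)) c_gt0)
      (has_mean_cst (f t) (ltW c_gt0)).
    by apply: has_mean_ext => x _; rewrite /difference addrA.
  apply: (has_mean_le c_gt0 (lin_mean c_gt0 LJ Zm)) => x /andP[x0 xc].
  by apply: Tn LC; rewrite x0 (le_trans xc).
pose W t := (mean c f (t + s) - mean c f t) - (mean h f t - mean c f t).
have cW : chirp_class J b W.
  apply: uc_class_chirp; apply: uc_classB.
    exact: (uc_class_mean_difference hJ lf s0 c_gt0 (df s0)).
  by rewrite hc; exact: (uc_class_mean_multiple hJ N lf c_gt0 df).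
have [m TW] := chirp_class_tame cW e20.
exists (m + n)%N; rewrite (splitr e).
apply: tame_ext (tameB TW TZ) => t Jt; rewrite /W /Z.
by move: (mean c f _) (mean c f _) (mean h f _) (f t) => A B C D; zmodule.
Qed.

End DifferenceProperty.

Section FunctionClassesUpToNullSets.
Context {R : realType} {X : completeNormedModType R[i]}.
Variables (J : set R) (hJ : J = `[0, +oo[%classic \/ J = setT).
Local Notation mu := (@lebesgue_measure R).
Implicit Types (f g u v : R -> X) (U V : set (R -> X)).
Local Notation luc := (loc_unif_continuous J).
Local Open Scope complex_scope.

Lemma unif_continuous_unif_cont f :
  unif_continuous (f : subspace J -> X) <-> unif_cont J f.
Proof.
split=> [/unif_continuous_subspaceP uf|uf].
  move=> e e0; have [d d0 fd] := uf e e0.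
  exists (d / 2); first by rewrite divr_gt0.
  move=> t x Jt /andP[x0 xd]; apply/ltW/fd => //; first exact: mem_addr.
  by rewrite addrAC subrr add0r ger0_norm//; lra.
apply/unif_continuous_subspaceP => e e0.
have [|d d0 fd] := uf (e / 2); first by rewrite divr_gt0.
have ordered s t : J s -> J t -> s <= t -> t - s < d -> rnorm (f t - f s) < e.
  move=> Js Jt st tsd; have -> : t = s + (t - s) by rewrite addrC subrK.
  rewrite (@le_lt_trans _ _ (e / 2))//; last by lra.
  by apply: fd => //; rewrite subr_ge0 st ltW.
exists d => // s t Js Jt; have [st|ts] := leP s t => std.
  rewrite rnormB; apply: ordered => //.
  by rewrite distrC ger0_norm ?subr_ge0 in std.
by apply: ordered => //; [exact: ltW|rewrite ger0_norm ?subr_ge0 ?ltW in std].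
Qed.

Definition represents b U :=
  forall f, U f <-> exists2 g, uc_class J b g & f = g %[ae mu in J].

Lemma represents_UC_BUC U : U = BUC J \/ U = UC J -> exists b, represents b U.
Proof.
case=> ->; [exists true|exists false] => f; split=> -[g gP fg]; exists g => //.
- by move: gP => /= [/unif_continuous_unif_cont ug /bounded_rnormP bg].
- by move: gP => [ug bg]; split;
    [exact/unif_continuous_unif_cont|exact/bounded_rnormP/bg].
- by split=> //; exact/unif_continuous_unif_cont.
- by case: gP => ug _; exact/unif_continuous_unif_cont.
Qed.

Lemma ae_difference f g s : 0 <= s -> f = g %[ae mu in J] ->
  difference s f = difference s g %[ae mu in J].
Proof.
move=> s0 fg; apply: ae_imply (ae_and fg (ae_shift s fg)) => t [ft fst] Jt.
rewrite /difference ft// (addrC t) fst// addrC; exact: mem_addr.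
Qed.

Lemma ae_on f g : (forall t, J t -> f t = g t) -> f = g %[ae mu in J].
Proof. by move=> fg; apply: aeW. Qed.

Lemma continuous_representative bU bV U V f :
  represents bU U -> represents bV V -> L1loc J f ->
  (forall s, 0 < s -> sum_class U (mul_class (@chirp R) V) (difference s f)) ->
  exists g, [/\ luc g, f = g %[ae mu in J] &
    forall s, 0 < s -> chirp_class J bU (difference s g)].
Proof.
move=> HU HV fJ fd.
have split_d s : 0 < s -> exists u v, [/\ uc_class J bU u, unif_cont J v &
    difference s f = (fun t => u t + chirp t *: v t) %[ae mu in J]].
  move=> /fd[u0 /HU[u uu uE]] [_ [v0 /HV[v [uv _] vE] <-] dE].
  exists u, v; split=> //; rewrite -dE.
  by apply: ae_imply (ae_and uE vE) => t [ut vt] Jt /=; rewrite ut// vt.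
have luv u v : uc_class J bU u -> unif_cont J v ->
    luc (fun t => u t + chirp t *: v t).
  move=> [uu _] uv; apply: (lucD hJ); first exact: unif_cont_luc.
  exact/(luc_chirp hJ)/unif_cont_luc.
have [g lg fg] : exists2 g, luc g & f = g %[ae mu in J].
  apply: (L1loc_ae_luc hJ fJ) => s /split_d[u [v [uu uv dE]]].
  by exists (fun t => u t + chirp t *: v t) => //; exact: luv.
exists g; split=> // s s0.
have exact_d r : 0 < r -> exists u v, [/\ uc_class J bU u, unif_cont J v &
    forall t, J t -> difference r g t = u t + chirp t *: v t].
  move=> r0; have [u [v [uu uv dE]]] := split_d r r0.
  exists u, v; split=> // t Jt; apply: (luc_ae_eq hJ _ (luv u v uu uv) _ Jt).
    exact: (luc_difference hJ lg (ltW r0)).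
  apply: ae_imply (ae_and dE (ae_difference (ltW r0) fg)) => y [dy ey] Jy.
  by rewrite -dy// ey.
have [u [v [uu uv gE]]] := exact_d s s0.
have [u' [v' [uu' uv' gE']]] := exact_d (s / 2) ltac:(by rewrite divr_gt0).
exists u, v; split=> //.
exact: (chirp_part_bounded hJ s0 uu.1 uv uu'.1 uv' gE gE').
Qed.

Lemma represents_BUC : represents true (BUC J).
Proof.
move=> f; split=> -[g gP fg]; exists g => //.
  by move: gP => /= [/unif_continuous_unif_cont ug /bounded_rnormP bg].
by move: gP => [ug bg]; split;
  [exact/unif_continuous_unif_cont|exact/bounded_rnormP/bg].
Qed.

End FunctionClassesUpToNullSets.

Theorem theorem4p2 (R : realType) (X : completeNormedModType R[i])
    (J : set R) (hJ : J = `[0, +oo[%classic \/ J = setT)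
    (U V : set (R -> X))
    (hU : U = BUC J \/ U = UC J) (hV : V = BUC J \/ V = UC J)
    (f : R -> X) (hf : L1loc J f)
    (hdiff : forall s : R, 0 < s ->
       sum_class U (mul_class (@chirp R) V) (difference s f)) :
  [/\ sum_class (Delta J U) (mul_class (@chirp R) (BUC J)) f,
      (forall h : R, 0 < h -> Delta J U (mean h f)) &
      has_Delta J (sum_class U (mul_class (@chirp R) V))].
Proof.
have [b HU] := represents_UC_BUC hJ hU.
have [b' HV] := represents_UC_BUC hJ hV.
have [g [lg fg gd]] := continuous_representative hJ HU HV hf hdiff.
have meanE h t : 0 < h -> J t -> mean h f t = mean h g t.
  by move=> h0 Jt; exact: (mean_ae hJ fg hf Jt h0).
split.
- have [u [v [uu uv bv guv]]] := mean_difference_chirp_class hJ lg gd ltr01.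
  pose w t := chirp t *: v t.
  have fw : (fun t => f t - w t) = (fun t => u t + mean 1 g t)
      %[ae lebesgue_measure in J].
    apply: ae_imply fg => t ft Jt; rewrite ft// -[g t](subrK (mean 1 g t)) guv//.
    by rewrite /w addrAC addrK.
  have lm := mean_luc hJ (luc_L1loc hJ lg) ltr01.
  exists (fun t => f t - w t); last first.
    exists w; last by apply/funext => t; rewrite /= subrK.
    by exists v => //; apply/represents_BUC => //; exists v => //; exact: ae_on.
  split.
    apply: (L1loc_ae (f := fun t => u t + mean 1 g t)).
      by apply: ae_imply fw => t E Jt; rewrite E.
    apply: (luc_L1loc hJ); apply: (lucD hJ) => //.
    exact/(unif_cont_luc hJ)/uu.1.
  move=> h h0; apply/HU.
  exists (fun t => (u (t + h) - u t) + (mean 1 g (t + h) - mean 1 g t)).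
    apply: (uc_classD hJ).
      by apply: uc_classB => //; exact: (uc_class_shift hJ (ltW h0)).
    exact: (uc_class_mean_difference hJ lg h0 ltr01 (gd h h0)).
  apply: ae_imply (ae_difference hJ (ltW h0) fw) => t E Jt; rewrite E//.
  rewrite /difference; move: (mean 1 g _) (mean 1 g _) (u _) (u _) => *.
  by zmodule.
- move=> h h0; split.
    apply: (L1loc_ae (f := mean h g)).
      by apply: ae_on => t Jt; rewrite meanE.
    exact/(luc_L1loc hJ)/(mean_luc hJ (luc_L1loc hJ lg) h0).
  move=> s s0; apply/HU; exists (fun t => mean h g (t + s) - mean h g t).
    exact: (uc_class_mean_difference hJ lg s0 h0 (gd s s0)).
  apply: ae_on => t Jt; rewrite /difference !meanE//.
  exact: (mem_addr hJ Jt (ltW s0)).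
move=> k kJ kdiff h h0.
have [g' [lg' kg' gd']] := continuous_representative hJ HU HV kJ kdiff.
have [u [v [uu uv bv guv]]] := mean_difference_chirp_class hJ lg' gd' h0.
pose w t := chirp t *: v t.
exists (fun t => k t - mean h k t - w t); last first.
  exists w; last by apply/funext => t; rewrite /= subrK.
  exists v => //; apply/HV; exists v; last exact: ae_on.
  exact: uc_class_BUC.
apply/HU; exists u => //.
have mk t : J t -> mean h k t = mean h g' t.
  by move=> Jt; exact: (mean_ae hJ kg' kJ Jt h0).
apply: ae_imply kg' => t kt Jt; rewrite kt// mk// guv//.
by rewrite /w addrK.
Qed.
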